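(* Let $X$ be a complex UMD Banach space. Let $q,q^*\in[2,\infty)$ be such that $X$ has cotype $q$ and its dual $X^*$ has cotype $q^*$, and put $s=\min(q,q^* )$. Let $T$ be a Kreiss bounded operator on $X$. Then $\|T^n\|=O\big(n/(\log n)^{1/s}\big)$ as $n\to\infty$; in particular $\|T^n\|=o(n)$.
   Context: A bounded linear operator $T$ on $X$ is Kreiss bounded if there is $C>0$ such that, for every $\lambda\in\mathbb{C}$ with $|\lambda|>1$, $\lambda I-T$ is invertible and $\|(\lambda I-T)^{-1}\|\le \frac{C}{|\lambda|-1}$. A Banach space $X$ is UMD (Unconditional Martingale Differences property) if for some (equivalently every) $p\in(1,\infty)$ there is $C_p>0$ such that for every $N$, every martingale difference sequence $(d_n)_{1\le n\le N}$ in some $L^p(\Omega,X,\nu)$ and every $(\varepsilon_n)_{1\le n\le N}\in\{-1,1\}^N$, $\|\sum_{n=1}^N\varepsilon_nd_n\|_{L^p(\Omega,X)}\le C_p\|\sum_{n=1}^Nd_n\|_{L^p(\Omega,X)}$. (UMD spaces are reflexive and have finite cotype, and $X$ is UMD if and only if $X^*$ is.) A Banach space $Y$ has (finite) cotype $q\in[2,\infty)$ if there is $K>0$ such that for all $n\ge 1$ and $y_1,\dots,y_n\in Y$, $\|y_1\|^q+\dots+\|y_n\|^q\le K\,\mathbb{E}(\|\varepsilon_1y_1+\dots+\varepsilon_ny_n\|^q)$, where $\varepsilon_1,\dots,\varepsilon_n$ are iid Rademacher variables (values $\pm1$ with probability $1/2$ each). *)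

(* Defs.v *)
From HB Require Import structures.
From mathcomp Require Import all_boot all_order all_algebra.
From mathcomp Require Import complex.
From mathcomp Require Import all_classical all_reals all_analysis.

Set Implicit Arguments.
Unset Strict Implicit.
Unset Printing Implicit Defensive.

Import Order.TTheory GRing.Theory Num.Theory.
Import numFieldNormedType.Exports.

Local Open Scope complex_scope.
Local Open Scope classical_set_scope.
Local Open Scope ring_scope.

Section real_norm.
Context {R : realType}.

(* A normed module over R[i] has its norm in R[i]; rnorm is the same norm with
   values in R (see rnormE). *)
Definition rnorm {V : normedModType R[i]} (x : V) : R := complex.Re `|x|.

(* For f linear and continuous this is the operator norm (see rnorm_opnorm);
   sup is junk when f is unbounded on the unit ball, so uses of opnorm are
   always accompanied by a continuity hypothesis. *)
Definition opnorm {V W : normedModType R[i]} (f : V -> W) : R :=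
  sup [set rnorm (f x) | x in [set x : V | rnorm x <= 1]].

Lemma rnormE {V : normedModType R[i]} (x : V) : `|x| = (rnorm x)%:C.
Proof. by rewrite /rnorm RRe_real// normr_real. Qed.

Lemma rnorm_ge0 {V : normedModType R[i]} (x : V) : 0 <= rnorm x.
Proof. by rewrite -ler0c -rnormE normr_ge0. Qed.

Lemma rnorm0 {V : normedModType R[i]} : rnorm (0 : V) = 0.
Proof. by rewrite /rnorm normr0. Qed.

Lemma rnorm_eq0 {V : normedModType R[i]} (x : V) : rnorm x = 0 -> x = 0.
Proof. by move=> h; apply/normr0_eq0; rewrite rnormE h. Qed.

Lemma rnormD {V : normedModType R[i]} (x y : V) :
  rnorm (x + y) <= rnorm x + rnorm y.
Proof. by rewrite -lecR rmorphD/= -!rnormE ler_normD. Qed.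

Lemma rnormZ {V : normedModType R[i]} (a : R[i]) (x : V) :
  rnorm (a *: x) = rnorm (a : R[i]^o) * rnorm x.
Proof.
by apply: complexI; rewrite rmorphM/= -!rnormE normrZ.
Qed.

Section opnorm_theory.
Context {V W : normedModType R[i]}.

Lemma linear_has_ubound (f : {linear V -> W}) : continuous f ->
  has_ubound [set rnorm (f x) | x in [set x : V | rnorm x <= 1]].
Proof.
move=> cf.
have /linear_boundedP := continuous_linear_bounded 0 (cf 0).
move=> [M [Mr fM]].
have M1 : M < `|M| + 1.
  by rewrite (le_lt_trans (real_ler_norm Mr))// ltrDl.
pose K := complex.Re (`|M| + 1).
have KE : `|M| + 1 = K%:C by rewrite RRe_real// realD.
have K0 : 0 <= K by rewrite -ler0c -KE addr_ge0.
exists K => _ [x x1 <-].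
have := fM _ M1 x; rewrite KE !rnormE -rmorphM/= lecR => /le_trans; apply.
by rewrite ler_piMr.
Qed.

Lemma opnorm_has_sup (f : {linear V -> W}) : continuous f ->
  has_sup [set rnorm (f x) | x in [set x : V | rnorm x <= 1]].
Proof.
by move=> cf; split; [exists (rnorm (f 0)), 0; rewrite //= rnorm0|
                      exact: linear_has_ubound].
Qed.

Lemma opnorm_ge0 (f : {linear V -> W}) : continuous f -> 0 <= opnorm f.
Proof.
move=> cf; apply: (@le_trans _ _ (rnorm (f 0))); first exact: rnorm_ge0.
apply: ub_le_sup; first exact: linear_has_ubound.
by exists 0; rewrite //= rnorm0.
Qed.

Lemma rnorm_opnorm (f : {linear V -> W}) (x : V) : continuous f ->
  rnorm (f x) <= opnorm f * rnorm x.
Proof.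
move=> cf; have [x0|x0] := eqVneq (rnorm x) 0.
  by rewrite (rnorm_eq0 x0) linear0 !rnorm0 mulr0.
have xgt0 : 0 < rnorm x by rewrite lt0r x0 rnorm_ge0.
have rV : rnorm (((rnorm x)^-1)%:C : R[i]^o) = (rnorm x)^-1.
  by rewrite {1}/rnorm ger0_norm// ler0c invr_ge0 ltW.
rewrite -ler_pdivrMr// mulrC.
apply: ub_le_sup; first exact: linear_has_ubound.
exists (((rnorm x)^-1)%:C *: x); rewrite /= ?linearZ/= rnormZ rV//.
by rewrite mulVf.
Qed.

Lemma opnorm_le (f : V -> W) (M : R) :
  (forall x, rnorm x <= 1 -> rnorm (f x) <= M) -> opnorm f <= M.
Proof.
move=> fM; apply: ge_sup; first by exists (rnorm (f 0)), 0; rewrite //= rnorm0.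
by move=> _ [x x1 <-]; exact: fM.
Qed.

End opnorm_theory.
End real_norm.

(* The dual X^* : continuous C-linear forms, with the operator norm. *)
Section dual.
Context {R : realType} (X : normedModType R[i]).

Definition is_dual : {pred (X -> R[i]^o)} :=
  [pred f : X -> R[i]^o | `[< linear f /\ continuous f >]].

Lemma is_dual_submod_closed : submod_closed is_dual.
Proof.
split.
  apply/asboolP; split; last exact: cst_continuous.
  by move=> a x y /=; rewrite scaler0 addr0.
move=> a f g /asboolP[lf cf] /asboolP[lg cg]; apply/asboolP; split.
  move=> b x y; rewrite !fctE lf lg /= !scalerDr.
  by rewrite addrACA !scalerA (mulrC a).
move=> x; apply: cvgD; last exact: cg.
by apply: cvgZr; exact: cf.
Qed.

HB.instance Definition _ := GRing.isSubmodClosed.Build R[i] (X -> R[i]^o)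
  is_dual is_dual_submod_closed.

Record dual := Dual { dual_fun :> X -> R[i]^o ; _ : dual_fun \in is_dual }.

HB.instance Definition _ := [isSub for dual_fun].
HB.instance Definition _ := [Choice of dual by <:].
HB.instance Definition _ := [SubChoice_isSubLmodule of dual by <:].

Lemma dual_linear (f : dual) : linear f.
Proof. by have /asboolP[] := valP f. Qed.

HB.instance Definition _ (f : dual) :=
  GRing.isLinear.Build R[i] X R[i]^o *:%R f (dual_linear f).

Lemma dual_continuous (f : dual) : continuous f.
Proof. by have /asboolP[] := valP f. Qed.

Let dnorm (f : dual) : R[i] := (opnorm f)%:C.

Let dnormD (f g : dual) : dnorm (f + g) <= dnorm f + dnorm g.
Proof.
rewrite /dnorm -rmorphD/= lecR; apply: opnorm_le => x x1.
rewrite (le_trans (rnormD _ _))// lerD//.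
- rewrite (le_trans (rnorm_opnorm _ (@dual_continuous f)))//.
  by rewrite ler_piMr// (opnorm_ge0 (@dual_continuous f)).
- rewrite (le_trans (rnorm_opnorm _ (@dual_continuous g)))//.
  by rewrite ler_piMr// (opnorm_ge0 (@dual_continuous g)).
Qed.

Let dnorm_eq0 (f : dual) : dnorm f = 0 -> f = 0.
Proof.
move=> /complexI f0; apply/val_inj/funext => x /=.
apply/rnorm_eq0/le_anti; rewrite rnorm_ge0 andbT.
by rewrite (le_trans (rnorm_opnorm _ (@dual_continuous f)))// f0 mul0r.
Qed.

Let dnormZ_le (a : R[i]) (f : dual) :
  opnorm (a *: f) <= rnorm (a : R[i]^o) * opnorm f.
Proof.
apply: opnorm_le => x x1; rewrite [leLHS]rnormZ ler_wpM2l ?rnorm_ge0//.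
rewrite (le_trans (rnorm_opnorm _ (@dual_continuous f)))//.
by rewrite ler_piMr// (opnorm_ge0 (@dual_continuous f)).
Qed.

Let dnormZ (a : R[i]) (f : dual) : dnorm (a *: f) = `|a| * dnorm f.
Proof.
rewrite -[`|a|]/(`|a : R[i]^o|) rnormE -rmorphM/=; congr (_%:C).
apply/le_anti; rewrite dnormZ_le/=.
have [->|a0] := eqVneq a 0.
  rewrite [rnorm _]rnorm0 mul0r.
  exact: (opnorm_ge0 (@dual_continuous (0 *: f))).
have ra : rnorm (a : R[i]^o) != 0.
  by apply: contra_neq a0; exact: rnorm_eq0.
rewrite mulrC -ler_pdivlMr ?lt0r ?ra ?rnorm_ge0//.
have := dnormZ_le a^-1 (a *: f); rewrite scalerK// => /le_trans; apply.
rewrite mulrC ler_wpM2l//; first exact: (opnorm_ge0 (@dual_continuous _)).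
suff -> : rnorm (a^-1 : R[i]^o) = (rnorm (a : R[i]^o))^-1 by [].
apply: complexI; rewrite -rnormE fmorphV/= -rnormE.
exact: normfV.
Qed.

HB.instance Definition _ :=
  Lmodule_isNormed.Build R[i] dual dnormD dnormZ dnorm_eq0.

Lemma dual_rnormE (f : dual) : rnorm f = opnorm f.
Proof. by []. Qed.

End dual.

Section kreiss.
Context {R : realType} {X : normedModType R[i]}.

Definition kreiss_bounded (T : {linear X -> X}) : Prop :=
  exists2 C : R, 0 < C &
  forall lambda : R[i], 1 < rnorm (lambda : R[i]^o) ->
  exists S : {linear X -> X},
    [/\ continuous S,
        forall x, S (lambda *: x - T x) = x,
        forall x, lambda *: S x - T (S x) = x &
        opnorm S <= C / (rnorm (lambda : R[i]^o) - 1)].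

End kreiss.

Section cotype.
Context {R : realType}.

(* E[f(eps_1, ..., eps_n)] for iid Rademacher signs, the joint law of which is
   uniform on the sign vectors; a sign is encoded as (-1) ^+ b, b : bool. *)
Definition rademacher_mean n (f : {ffun 'I_n -> bool} -> R) : R :=
  (\sum_(e : {ffun 'I_n -> bool}) f e) / 2 ^+ n.

Definition has_cotype (Y : normedModType R[i]) (q : R) : Prop :=
  exists2 K : R, 0 < K &
  forall n (y : 'I_n -> Y), (1 <= n)%N ->
    \sum_(i < n) rnorm (y i) `^ q <=
    K * rademacher_mean
          (fun e => rnorm (\sum_(i < n) (-1) ^+ e i *: y i) `^ q).

End cotype.

(* X-valued integration; sub-sigma-algebras are sets G : set (set Omega). *)
Section bochner.
Context {R : realType} {X : normedModType R[i]}.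
Context d {Omega : measurableType d} (P : probability Omega R).

Definition simple_fun (G : set (set Omega)) (s : Omega -> X) : Prop :=
  finite_set (range s) /\ forall x, G (s @^-1` [set x]).

Definition strongly_measurable (G : set (set Omega)) (f : Omega -> X) : Prop :=
  exists s : nat -> Omega -> X, (forall k, simple_fun G (s k)) /\
    forall w, s k w @[k --> \oo] --> f w.

Definition simple_integral (A : set Omega) (s : Omega -> X) : X :=
  \sum_(x \in range s) (fine (P (A `&` s @^-1` [set x])))%:C *: x.

(* f is Bochner integrable over A, with integral v *)
Definition is_bochner_integral (A : set Omega) (f : Omega -> X) (v : X) :
    Prop :=
  strongly_measurable measurable f /\
  exists s : nat -> Omega -> X,
    [/\ forall k, simple_fun measurable (s k),
        (\int[P]_(w in A) (rnorm (f w - s k w))%:E)%E @[k --> \oo] --> 0%E &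
        simple_integral A (s k) @[k --> \oo] --> v].

(* g is a version of E[f | G] *)
Definition is_condexp (G : set (set Omega)) (f g : Omega -> X) : Prop :=
  strongly_measurable G g /\
  forall A, G A ->
    exists v, is_bochner_integral A f v /\ is_bochner_integral A g v.

Definition LpX_norm (p : R) (f : Omega -> X) : \bar R :=
  ('N[P]_p%:E [EFin \o rnorm \o f])%E.

Definition filtration (N : nat) (F : nat -> set (set Omega)) : Prop :=
  (forall n, (n <= N)%N ->
     sigma_algebra setT (F n) /\ F n `<=` measurable) /\
  (forall n, (n < N)%N -> F n `<=` F n.+1).

(* (D_n)_{1 <= n <= N}, with respect to F_0, ..., F_N *)
Definition martingale_difference (p : R) (N : nat)
    (F : nat -> set (set Omega)) (D : nat -> Omega -> X) : Prop :=
  filtration N F /\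
  forall n, (1 <= n <= N)%N ->
    [/\ strongly_measurable (F n) (D n),
        (LpX_norm p (D n) < +oo)%E &
        is_condexp (F n.-1) (D n) (cst 0)].

End bochner.

Definition UMD {R : realType} (X : normedModType R[i]) : Prop :=
  exists p : R, 1 < p /\
  exists C : R, 0 < C /\
  forall (d : measure_display) (Omega : measurableType d)
         (P : probability Omega R) (N : nat)
         (F : nat -> set (set Omega)) (D : nat -> Omega -> X)
         (eps : nat -> bool),
    martingale_difference P p N F D ->
    (LpX_norm P p (fun w => \sum_(1 <= n < N.+1) (-1) ^+ eps n *: D n w)%R <=
     C%:E * LpX_norm P p (fun w => \sum_(1 <= n < N.+1) D n w)%R)%E.

(* Main.v *)
(* Write u_N(z) = N^-1 (1 - (1 - 1/N) z T)^-1 for |z| = 1, so that |u_N| <= C by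
   Kreiss boundedness, and let beta_N be the norm of h |-> E[u_N^2 h] from
   L^p(circle, X) to X.  Since (n+1) r^n T^n is the n-th Fourier coefficient of
   (1 - r z T)^-2, a bound on beta_N for N = 2n bounds |T^n| / n.

   By the resolvent identity u_N'^2 u_N^2 = u_N^2 + O(N'/N).  Hence, with
   k = u_N^2 h, E[u_N^2 h] is close to E[u_N'^2 k] for each of H scales N' << N.
   The function u_N'^2 lives at frequency about N': it is nearly constant on
   arcs shorter than 1/N', and, being nearly a derivative, it has small mean
   over longer arcs.  So k may be replaced by the increment d_N' of its
   conditional expectations on arcs slightly longer and slightly shorter than
   1/N', at the cost of errors that are small when the scales are well
   separated.  The d_N' are martingale differences, and UMD together with
   cotype forces the average of their L^p norms over the H scales to be at most
   a small multiple of the L^p norm of k.  Thus beta_N is at most half of the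
   supremum of the beta_N', once H is a large constant.  Iterating over groups
   of H scales, with logarithms of the scales in arithmetic progression, beta_N
   decays faster than any power of log N, which is more than is claimed.  Only
   the cotype of X is needed.

   The circle is replaced by the M-th roots of unity, M a large power of 2, so
   that all expectations are finite sums. *)

Require Import Defs.
From HB Require Import structures.
From mathcomp Require Import all_boot all_order all_algebra.
From mathcomp Require Import complex ring lra zify.
From mathcomp Require Import all_classical all_reals all_analysis.

Set Implicit Arguments.
Unset Strict Implicit.
Unset Printing Implicit Defensive.

Import Order.TTheory GRing.Theory Num.Theory.
Import numFieldNormedType.Exports.

Local Open Scope complex_scope.
Local Open Scope classical_set_scope.
Local Open Scope ring_scope.

(** * Kahane's inequality and cotype *)

Section norm_facts.
Context {R : realType} {X : normedModType R[i]}.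
Implicit Types x y : X.

Lemma rnormN x : rnorm (- x) = rnorm x.
Proof. by rewrite /rnorm normrN. Qed.

Lemma rnormB x y : rnorm (x - y) <= rnorm x + rnorm y.
Proof. by rewrite (le_trans (rnormD _ _))// rnormN. Qed.

Lemma rnorm_sum (I : Type) (r : seq I) (P : pred I) (F : I -> X) :
  rnorm (\sum_(i <- r | P i) F i) <= \sum_(i <- r | P i) rnorm (F i).
Proof.
elim/big_ind2 : _ => [|x1 x2 y1 y2 h1 h2|//]; first by rewrite rnorm0.
by rewrite (le_trans (rnormD _ _))// lerD.
Qed.

(** The expectation of [phi] at [x] plus the Rademacher sum of [s]. The recursion conditions on the
    first sign, so that stopping-time arguments become inductions on [s]. *)
Fixpoint signs_mean (s : seq X) (phi : X -> R) (x : X) : R :=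
  if s is y :: s' then
    (signs_mean s' phi (x + y) + signs_mean s' phi (x - y)) / 2
  else phi x.

Lemma signs_mean_le s (phi psi : X -> R) x : (forall z, phi z <= psi z) ->
  signs_mean s phi x <= signs_mean s psi x.
Proof.
move=> h; elim: s x => [|y s IH] x //=.
by rewrite ler_pM2r ?invr_gt0 ?ltr0n// lerD.
Qed.

Lemma signs_meanD s (phi psi : X -> R) x :
  signs_mean s (fun z => phi z + psi z) x =
  signs_mean s phi x + signs_mean s psi x.
Proof. by elim: s x => [|y s IH] x //=; rewrite !IH; field. Qed.

Lemma signs_meanZ s c (phi : X -> R) x :
  signs_mean s (fun z => c * phi z) x = c * signs_mean s phi x.
Proof. by elim: s x => [|y s IH] x //=; rewrite !IH; field. Qed.

Lemma signs_mean_cst s c x : signs_mean s (fun=> c) x = c.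
Proof. by elim: s x => [|y s IH] x //=; rewrite !IH; field. Qed.

Lemma signs_mean_sum s n (phi : 'I_n -> X -> R) x :
  signs_mean s (fun z => \sum_(k < n) phi k z) x =
  \sum_(k < n) signs_mean s (phi k) x.
Proof.
elim: n phi => [|n IH] phi.
  rewrite big_ord0; rewrite -[RHS](signs_mean_cst s 0 x).
  by congr signs_mean; apply/funext => z; rewrite big_ord0.
rewrite big_ord_recr/= -IH -signs_meanD.
by congr signs_mean; apply/funext => z; rewrite big_ord_recr.
Qed.

Lemma signs_mean_shift s (phi : X -> R) x y :
  signs_mean s phi (x + y) = signs_mean s (fun z => phi (z + y)) x.
Proof.
elim: s x => [|v s IH] x //=.
by rewrite -!IH ![_ + y + _]addrAC.
Qed.

(** Flipping all signs preserves the law and reflects the sums about their centre [x]. *)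
Lemma signs_mean_refl s (phi : X -> R) x :
  signs_mean s phi x = signs_mean s (fun z => phi (x + x - z)) x.
Proof.
have H z : signs_mean s phi z =
    signs_mean s (fun w => phi (- w)) (- z).
  elim: s z => [|y s IH] z /=; first by rewrite opprK.
  by rewrite !IH opprD opprB addrC [y - z]addrC.
rewrite H; have -> : - x = x + (- (x + x)) by rewrite opprD addrA subrr add0r.
rewrite signs_mean_shift; congr signs_mean; apply/funext => z.
by rewrite opprD opprK addrC.
Qed.

(** * Tails of Rademacher sums *)

Definition exceeds (t : R) (x : X) : R := (t < rnorm x)%R%:R.

Lemma exceeds_ge0 t x : 0 <= exceeds t x.
Proof. exact: ler0n. Qed.

Lemma exceeds_midpoint t x y :
  exceeds t x <= exceeds t (x + y) + exceeds t (x - y).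
Proof.
rewrite /exceeds; case: (ltP t (rnorm x)) => h; last by rewrite addr_ge0.
case: (ltP t (rnorm (x + y))) => h1; first by rewrite lerDl.
case: (ltP t (rnorm (x - y))) => h2; first by rewrite add0r.
have : rnorm (x + x) <= t + t.
  have -> : x + x = (x + y) + (x - y) by rewrite addrACA subrr addr0.
  by rewrite (le_trans (rnormD _ _))// lerD.
have -> : x + x = 2 *: x by rewrite scaler_nat mulr2n.
rewrite rnormZ; have -> : rnorm (2 : R[i]^o) = 2.
  apply: complexI; rewrite -rnormE rmorph_nat.
  by rewrite ger0_norm// ler0n.
by move=> h3; move: h; rewrite ltNge => /negP[]; lra.
Qed.

Definition tail (s : seq X) (t : R) : R := signs_mean s (exceeds t) 0.

Lemma tail_ge0 s t : 0 <= tail s t.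
Proof.
rewrite -[0 in leLHS](signs_mean_cst s 0 0); apply: signs_mean_le => z.
exact: exceeds_ge0.
Qed.

Lemma signs_mean_cat s1 s2 (phi : X -> R) x :
  signs_mean (s1 ++ s2) phi x = signs_mean s1 (signs_mean s2 phi) x.
Proof. by elim: s1 x => [|y s1 IH] x //=; rewrite !IH. Qed.

(** A sum [z] over the suffix is the midpoint of [z + w] and [z - w], where [w] is the sum over the
    prefix; by symmetry both have the law of the full sum. *)
Lemma tail_suffix s1 s2 t : tail s2 t <= 2 * tail (s1 ++ s2) t.
Proof.
rewrite /tail signs_mean_cat.
have H w : tail s2 t <= signs_mean s2 (exceeds t) w + signs_mean s2 (exceeds t) (- w).
  rewrite -[w]add0r -[- (0 + w)]add0r !signs_mean_shift -signs_meanD add0r.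
  by apply: signs_mean_le => z; exact: exceeds_midpoint.
have := signs_mean_le s1 0 H; rewrite signs_mean_cst signs_meanD => /le_trans; apply.
rewrite [X in _ + X](_ : _ = signs_mean s1 (signs_mean s2 (exceeds t)) 0); last first.
  rewrite [RHS]signs_mean_refl; congr signs_mean; apply/funext => z.
  by rewrite addr0 add0r.
by rewrite mulr_natl mulr2n.
Qed.

(** The point [x] is the midpoint of the sum [z] and of its reflection [x + x - z], which have the
    same law; one of the two must leave the ball. *)
Lemma exceeds_mid_mean s t x : t < rnorm x ->
  1 <= 2 * signs_mean s (exceeds t) x.
Proof.
move=> tx; rewrite mulr_natl mulr2n {1}signs_mean_refl -signs_meanD.
rewrite -[leLHS](signs_mean_cst s 1 x); apply: signs_mean_le => z.
have := exceeds_midpoint t x (x - z); rewrite /exceeds tx => /le_trans; apply.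
by rewrite addrA subKr.
Qed.

(* The probability that some partial sum exceeds t in norm. *)
Fixpoint maximal_tail (t : R) (s : seq X) (x : X) : R :=
  if t < rnorm x then 1 else
  if s is y :: s' then
    (maximal_tail t s' (x + y) + maximal_tail t s' (x - y)) / 2
  else 0.

(** Lévy's maximal inequality: after a partial sum has left the ball, the final sum lies outside
    with probability at least 1/2. *)
Lemma maximal_tail_le t s x :
  maximal_tail t s x <= 2 * signs_mean s (exceeds t) x.
Proof.
elim: s x => [|y s IH] x /=.
  by case: ltP => h; rewrite ?mulr_ge0 ?exceeds_ge0// /exceeds h/= mulr1 ler1n.
case: ltP => h; first exact: (exceeds_mid_mean (y :: s)).
have := IH (x + y); have := IH (x - y); lra.
Qed.

(* At the first time the partial sums exceed t, the rest of the sum must again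
   exceed t for the total to exceed 2 t. *)
Lemma tail_maximal (theta t : R) s x :
  (forall s1 y s2, s = s1 ++ y :: s2 ->
     signs_mean s2 (exceeds t) y <= theta /\
     signs_mean s2 (exceeds t) (- y) <= theta) ->
  0 <= theta -> rnorm x <= t ->
  signs_mean s (exceeds (2 * t)) x <= maximal_tail t s x * theta.
Proof.
move=> + th0; elim: s x => [|y s IH] x H xt /=.
  by rewrite ltNge xt/= mul0r /exceeds ltNge; have -> : rnorm x <= 2 * t by have := rnorm_ge0 x; lra.
rewrite ltNge xt/=.
have [Hp Hm] := H [::] y s erefl.
have key z : signs_mean s (exceeds t) z <= theta ->
   signs_mean s (exceeds (2 * t)) (x + z) <= maximal_tail t s (x + z) * theta.
  move=> Hz; have [h|h] := leP (rnorm (x + z)) t.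
    by apply: IH => // s1 y' s2 E; apply: (H (y :: s1)); rewrite E.
  have -> : maximal_tail t s (x + z) = 1 by case: s {IH H Hp Hm Hz} => [|? ?] /=; rewrite h.
  (* The jump [z] is counted with the remaining sum. The position [x] before the jump still has norm
     at most [t], so the two together must exceed [t]. *)
  rewrite mul1r (le_trans _ Hz)// addrC signs_mean_shift; apply: signs_mean_le => w.
  rewrite /exceeds; case: ltP => // h1; case: ltP => // h2.
  exfalso; move: h1; rewrite ltNge => /negP[].
  by have := rnormD w x; lra.
have := key y Hp; have := key (- y) Hm; lra.
Qed.

(** One factor 2 is Lévy's inequality for the first exit, the other the passage from the remaining
    sum to the full sum. *)
Lemma tail_sqr s t : 0 <= t -> tail s (2 * t) <= 4 * tail s t ^+ 2.
Proof.
move=> t0.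
have H s1 y s2 : s = s1 ++ y :: s2 ->
     signs_mean s2 (exceeds t) y <= 2 * tail s t /\
     signs_mean s2 (exceeds t) (- y) <= 2 * tail s t.
  move=> ->.
  have E : signs_mean s2 (exceeds t) (- y) = signs_mean s2 (exceeds t) y.
    rewrite -[- y]add0r -[y in RHS]add0r !signs_mean_shift signs_mean_refl.
    congr signs_mean; apply/funext => z; rewrite /exceeds.
    by rewrite addr0 add0r -opprD rnormN.
  rewrite E; split; rewrite (le_trans _ (tail_suffix s1 (y :: s2) t))// /tail/= add0r sub0r E;
  lra.
have := tail_maximal H (mulr_ge0 (ler0n _ 2) (tail_ge0 s t)).
move=> /(_ 0); rewrite rnorm0 => /(_ t0) /le_trans; apply.
rewrite [leRHS](_ : _ = (2 * tail s t) * (2 * tail s t)); last by ring.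
by rewrite ler_wpM2r ?mulr_ge0 ?tail_ge0//; exact: maximal_tail_le.
Qed.

(** The factor 4 makes [tail_sqr] a pure squaring, so the tails decay doubly exponentially once
    [4 * tail s t] is below 1. *)
Lemma tail_iter s t k : 0 <= t ->
  4 * tail s (2 ^+ k * t) <= (4 * tail s t) ^+ (2 ^ k).
Proof.
move=> t0; elim: k => [|k IH]; first by rewrite expr0 mul1r expn0 expr1.
rewrite exprS -mulrA.
have h0 : 0 <= 2 ^+ k * t by rewrite mulr_ge0// exprn_ge0.
have := tail_sqr s h0 => h.
apply: (@le_trans _ _ ((4 * tail s (2 ^+ k * t)) ^+ 2)).
  by rewrite exprMn; lra.
by rewrite expnS mulnC exprM lerXn2r// ?nnegrE ?exprn_ge0 ?mulr_ge0 ?tail_ge0.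
Qed.

(** The sums of [s] stay in a fixed ball around [x], so a comparison of [phi] and [psi] on a ball
    suffices. This keeps the layer decomposition below finite. *)
Lemma signs_norm_bounded s : exists K : nat, forall x (phi psi : X -> R),
  (forall z, rnorm z <= rnorm x + K%:R -> phi z <= psi z) ->
  signs_mean s phi x <= signs_mean s psi x.
Proof.
elim: s => [|y s [K HK]].
  by exists 0 => x phi psi; apply; rewrite addr0.
have [N HN] : exists N : nat, rnorm y <= N%:R.
  by exists (Num.bound (rnorm y)); rewrite ltW// archi_boundP// rnorm_ge0.
exists (N + K)%N => x phi psi H /=.
rewrite ler_pM2r ?invr_gt0 ?ltr0n// lerD//; apply: HK => z hz; apply: H;
  rewrite natrD (le_trans hz)// addrA lerD2r.
  by rewrite (le_trans (rnormD _ _))// lerD2l.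
by rewrite (le_trans (rnormB _ _))// lerD2l.
Qed.

Lemma powR_layers (q t v : R) n : 0 < q -> 0 <= t -> 0 <= v -> v <= 2 ^+ n * t ->
  v `^ q <= t `^ q + \sum_(k < n)
     (t `^ q * (2 `^ q) ^+ k.+1) * (2 ^+ k * t < v)%R%:R.
Proof.
move=> q0 t0 v0; elim: n => [|n IH].
  rewrite expr0 mul1r big_ord0 addr0 => h.
  by rewrite ge0_ler_powR// ltW.
move=> h; rewrite big_ord_recr/=; case: ltP => h1.
  rewrite mulr1 addrA (@le_trans _ _ (t `^ q * (2 `^ q) ^+ n.+1))//; last first.
    rewrite lerDr addr_ge0 ?powR_ge0// sumr_ge0// => k _.
    by rewrite !mulr_ge0// ?exprn_ge0// ?powR_ge0.
  rewrite -powR_mulrn ?powR_ge0// powRAC -powRM// ?powR_ge0//.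
  rewrite powR_mulrn//.
  apply: ge0_ler_powR; rewrite ?nnegrE ?(ltW q0)// ?mulr_ge0 ?exprn_ge0//.
  by rewrite mulrC.
by rewrite mulr0 addr0; exact: IH.
Qed.

Lemma kahane_tail (q t : R) s : 0 < q -> 0 < t ->
  4 * tail s t <= (2 * 2 `^ q)^-1 ->
  signs_mean s (fun z => rnorm z `^ q) 0 <= 2 * t `^ q.
Proof.
move=> q0 tgt ht; have t0 := ltW tgt.
have [K HK] := signs_norm_bounded s.
have [n hn] : exists n : nat, K%:R <= 2 ^+ n * t.
  exists (Num.bound (K%:R / t)); rewrite -ler_pdivrMr//.
  apply: (@le_trans _ _ (Num.bound (K%:R / t : R))%:R).
    by rewrite ltW// archi_boundP// divr_ge0.
  by rewrite -natrX ler_nat ltnW// ltn_expl.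
apply: (@le_trans _ _ (signs_mean s (fun z => t `^ q + \sum_(k < n)
     (t `^ q * (2 `^ q) ^+ k.+1) * exceeds (2 ^+ k * t) z) 0)).
  apply: HK => z; rewrite rnorm0 add0r => hz.
  by apply: powR_layers => //; [exact: rnorm_ge0|exact: le_trans hz hn].
rewrite signs_meanD signs_mean_cst signs_mean_sum.
have Hk (k : 'I_n) : signs_mean s (fun z => (t `^ q * (2 `^ q) ^+ k.+1) * exceeds (2 ^+ k * t) z) 0
   <= t `^ q * (2^-1 ^+ k.+1 / 4).
  rewrite signs_meanZ -/(tail s _) -mulrA ler_wpM2l ?powR_ge0//.
  have h := tail_iter s k t0.
  have h2 : (4 * tail s t) ^+ (2 ^ k) <= ((2 * 2 `^ q)^-1) ^+ k.+1.
    apply: (@le_trans _ _ ((2 * 2 `^ q)^-1 ^+ (2 ^ k))).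
      by rewrite lerXn2r// ?nnegrE ?mulr_ge0 ?tail_ge0// invr_ge0 mulr_ge0 ?powR_ge0.
    apply: ler_wiXn2l; last by rewrite ltn_expl.
      by rewrite invr_ge0 mulr_ge0 ?powR_ge0.
    rewrite invf_le1 ?mulr_gt0 ?powR_gt0//.
    have : 1 <= 2 `^ q :> R by rewrite -[leLHS](powRr0 2) ler_powR ?ler1n// ltW.
    lra.
  have h3 := le_trans h h2.
  have q2 : 0 < (2 `^ q) ^+ k.+1 :> R by rewrite exprn_gt0 ?powR_gt0.
  have -> : 2^-1 ^+ k.+1 / 4 = (2 `^ q) ^+ k.+1 * ((2 * 2 `^ q)^-1 ^+ k.+1 / 4) :> R.
    rewrite invfM exprMn [RHS](_ : _ = 2^-1 ^+ k.+1 / 4 * ((2 `^ q) ^+ k.+1 * (2 `^ q)^-1 ^+ k.+1)); last by ring.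
    by rewrite -exprMn mulfV ?expr1n ?mulr1// gt_eqF// powR_gt0.
  by rewrite ler_pM2l//; lra.
have := ler_sum (index_enum _) (fun (k : 'I_n) (_ : true) => Hk k).
rewrite -mulr_sumr => hs.
have geo m : \sum_(k < m) (2^-1 ^+ k.+1 / 4 : R) <= 1 - 2^-1 ^+ m.
  elim: m => [|m IH]; first by rewrite big_ord0 expr0 subrr.
  rewrite big_ord_recr/= exprS.
  have : 0 <= 2^-1 ^+ m :> R by rewrite exprn_ge0// invr_ge0.
  by lra.
have hg : \sum_(k < n) (2^-1 ^+ k.+1 / 4 : R) <= 1.
  have := geo n; have : 0 <= 2^-1 ^+ n :> R by rewrite exprn_ge0// invr_ge0.
  lra.
by rewrite mulr_natl mulr2n lerD2l (le_trans hs)// ler_piMr// powR_ge0.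
Qed.

Lemma kahane (p q m : R) s : 0 < p -> 0 < q -> 0 < m ->
  signs_mean s (fun z => rnorm z `^ p) 0 <= m ->
  signs_mean s (fun z => rnorm z `^ q) 0 <=
  2 * ((8 * 2 `^ q) * m) `^ (q / p).
Proof.
move=> p0 q0 m0 hm.
set A := 8 * 2 `^ q.
have A0 : 0 < A by rewrite mulr_gt0// powR_gt0.
have Am : 0 < A * m by rewrite mulr_gt0.
set t := (A * m) `^ p^-1.
have tp : t `^ p = A * m by rewrite -powRrM mulVf ?gt_eqF// powRr1// ltW.
have -> : (A * m) `^ (q / p) = t `^ q by rewrite /t -powRrM [p^-1 * q]mulrC.
apply: kahane_tail => //; first by rewrite powR_gt0.
have : t `^ p * tail s t <= m.
  rewrite (le_trans _ hm)// -signs_meanZ; apply: signs_mean_le => z.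
  rewrite /exceeds; case: ltP => h; last by rewrite mulr0 powR_ge0.
  by rewrite mulr1 ge0_ler_powR ?nnegrE ?powR_ge0 ?rnorm_ge0// ltW.
rewrite tp mulrAC -ler_pdivlMr// divff ?gt_eqF// => h.
have q2 : 0 < 2 `^ q :> R by rewrite powR_gt0.
rewrite -[leRHS]mul1r ler_pdivlMr ?mulr_gt0//.
by rewrite /A in h; lra.
Qed.

End norm_facts.

Section cotype_gain.
Context {R : realType} {X : normedModType R[i]}.

Lemma rademacher_mean_signs n (y : 'I_n -> X) (phi : X -> R) x :
  rademacher_mean (fun e => phi (x + \sum_(i < n) (-1) ^+ e i *: y i)) =
  signs_mean [seq y i | i <- enum 'I_n] phi x.
Proof.
elim: n y x => [|n IH] y x.
  rewrite /rademacher_mean expr0 divr1 (_ : enum 'I_0 = [::]); last first.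
    by apply: size0nil; rewrite size_enum_ord.
  rewrite /= (bigD1 [ffun=> false])//= big_ord0 addr0 big1 ?addr0// => e /eqP[].
  by apply/ffunP => -[].
rewrite enum_ordSl /= -map_comp -[map _ _]/[seq (y \o lift ord0) i | i <- enum 'I_n].
rewrite -!IH /rademacher_mean.
pose h (be : bool * {ffun 'I_n -> bool}) : {ffun 'I_n.+1 -> bool} :=
  [ffun i => if unlift ord0 i is Some j then be.2 j else be.1].
pose g (e : {ffun 'I_n.+1 -> bool}) : bool * {ffun 'I_n -> bool} :=
  (e ord0, [ffun j => e (lift ord0 j)]).
have hK : cancel h g.
  case=> b e; rewrite /g /h ffunE unlift_none/=; congr pair.
  by apply/ffunP => j; rewrite !ffunE liftK.
have gK : cancel g h.
  move=> e; apply/ffunP => i; rewrite /h /g ffunE/=.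
  by case: unliftP => [j|] ->; rewrite ?ffunE.
rewrite (reindex h) /=; last by exists g => ? _; [exact: hK|exact: gK].
rewrite -(pair_bigA _ (fun b e => phi (x + \sum_(i < n.+1) (-1) ^+ h (b, e) i *: y i)))/=.
rewrite big_bool/= exprS.
have E b (e : {ffun 'I_n -> bool}) : x + \sum_(i < n.+1) (-1) ^+ h (b, e) i *: y i =
    x + (-1) ^+ b *: y ord0 + \sum_(i < n) (-1) ^+ e i *: (y \o lift ord0) i.
  rewrite big_ord_recl ffunE unlift_none/= addrA; congr (_ + _).
  by apply: eq_bigr => i _; rewrite ffunE liftK.
under eq_bigr do rewrite E expr1 scaleN1r.
under [X in _ + X]eq_bigr do rewrite E expr0 scale1r.
have : (2 : R) ^+ n != 0 by rewrite expf_neq0// pnatr_eq0.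
by move=> ?; field.
Qed.

(* Splits at a = eta: a^p <= eta^p below, a^p <= (...) a^q above. *)
Lemma powR_split (p q eta A a : R) : 0 < p -> 0 < eta -> 0 <= a -> a <= A ->
  a `^ p <= eta `^ p + (eta `^ (p - q) + A `^ (p - q)) * a `^ q.
Proof.
move=> p0 e0 a0 aA; have [h|h] := leP a eta.
  rewrite (@le_trans _ _ (eta `^ p))//.
    by rewrite ge0_ler_powR ?nnegrE// ltW.
  by rewrite lerDl mulr_ge0 ?addr_ge0 ?powR_ge0.
have ag := lt_trans e0 h.
rewrite -[in leLHS](subrK q p) [leLHS]powRD; last by rewrite (gt_eqF ag) implybT.
rewrite (@le_trans _ _ ((eta `^ (p - q) + A `^ (p - q)) * a `^ q))//; last first.
  by rewrite lerDr powR_ge0.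
rewrite ler_wpM2r ?powR_ge0//.
have [pq|pq] := leP 0 (p - q).
  rewrite (@le_trans _ _ (A `^ (p - q)))// ?lerDr ?powR_ge0//.
  by rewrite ge0_ler_powR ?nnegrE// (le_trans a0).
rewrite (@le_trans _ _ (eta `^ (p - q)))// ?lerDl ?powR_ge0//.
rewrite -(opprK (p - q)) ![_ `^ - - _]powRN lef_pV2 ?posrE ?powR_gt0//.
by rewrite ge0_ler_powR ?nnegrE ?oppr_ge0// ltW.
Qed.

(* Cotype q, transferred to exponent p by Kahane's inequality and only in the
   qualitative form that is used. *)
Lemma cotype_gain (p q e : R) : 0 < p -> 0 < q -> has_cotype X q -> 0 < e ->
  exists H : nat, (0 < H)%N /\ forall y : 'I_H -> X,
    \sum_(i < H) rnorm (y i) `^ p <= e * H%:R *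
      rademacher_mean (fun s => rnorm (\sum_(i < H) (-1) ^+ s i *: y i) `^ p).
Proof.
move=> p0 q0 [K K0 cot] e0.
pose K2 := K * (2 * (8 * 2 `^ q) `^ (q / p)).
have K20 : 0 < K2 by rewrite !mulr_gt0// !powR_gt0// mulr_gt0// powR_gt0.
pose eta := (e / 2) `^ p^-1.
have eta0 : 0 < eta by rewrite powR_gt0// divr_gt0.
have etap : eta `^ p = e / 2 by rewrite -powRrM mulVf ?gt_eqF// powRr1// divr_ge0// ltW.
pose A := K2 `^ q^-1.
pose c := eta `^ (p - q) + A `^ (p - q).
have c0 : 0 <= c by rewrite addr_ge0// powR_ge0.
(* After normalization the terms below [eta] contribute at most [e / 2] each. Those above contribute
   at most [c * K2] in total, which is at most [e / 2 * H%:R] for this [H]. *)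
pose H := (Num.bound (c * K2 / (e / 2))).+1.
have HH : c * K2 <= e / 2 * H%:R.
  rewrite [leRHS]mulrC -ler_pdivrMr ?divr_gt0//.
  apply: (@le_trans _ _ (Num.bound (c * K2 / (e / 2)))%:R); last first.
    by rewrite /H ler_nat.
  by apply/ltW/archi_boundP; rewrite divr_ge0 ?mulr_ge0 ?divr_ge0// ltW.
exists H; split => // y; set s := rademacher_mean _.
have s0 : 0 <= s.
  by rewrite /s/rademacher_mean divr_ge0 ?exprn_ge0// sumr_ge0// => ? _; exact: powR_ge0.
(* The mean [s] may vanish; a strict majorant [m] is positive, which allows the division by [u]
   below. *)
suff key m : s < m -> \sum_(i < H) rnorm (y i) `^ p <= e * H%:R * m.
  apply/ler_addgt0Pr => d d0; have eH : 0 < e * H%:R by rewrite mulr_gt0// ltr0n.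
  have := key (s + d / (e * H%:R)); rewrite ltrDl divr_gt0// => /(_ isT) /le_trans; apply.
  by rewrite mulrDr [X in _ + X]mulrC divfK// gt_eqF.
move=> sm; have m0 := le_lt_trans s0 sm.
have Es r : rademacher_mean (fun s => rnorm (\sum_(i < H) (-1) ^+ s i *: y i) `^ r) =
   signs_mean [seq y i | i <- enum 'I_H] (fun z => rnorm z `^ r) 0.
  rewrite -rademacher_mean_signs; congr rademacher_mean; apply/funext => z.
  by rewrite add0r.
have := kahane p0 q0 m0 (s := [seq y i | i <- enum 'I_H]); rewrite -!Es => /(_ (ltW sm)) kh.
have hq : \sum_(i < H) rnorm (y i) `^ q <= K2 * m `^ (q / p).
  rewrite (le_trans (cot H y isT))//.
  rewrite powRM ?(ltW m0) ?mulr_ge0 ?powR_ge0// in kh.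
  by have := ler_wpM2l (ltW K0) kh; rewrite /K2 !mulrA.
pose u := m `^ p^-1.
have u0 : 0 < u by rewrite powR_gt0.
have up : u `^ p = m by rewrite -powRrM mulVf ?gt_eqF// powRr1// ltW.
have uq : u `^ q = m `^ (q / p) by rewrite /u -powRrM [p^-1 * q]mulrC.
clearbody u.
pose a i := rnorm (y i) / u.
have a0 i : 0 <= a i by rewrite divr_ge0 ?rnorm_ge0// ltW.
have ya i : rnorm (y i) = a i * u by rewrite /a divfK// gt_eqF.
have haq : \sum_(i < H) a i `^ q <= K2.
  rewrite -(ler_pM2r (_ : 0 < u `^ q)) ?powR_gt0//.
  rewrite mulr_suml uq (le_trans _ hq)// ler_sum// => i _.
  by rewrite ya (powRM q (a0 i) (ltW u0)) uq.
have aA i : a i <= A.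
  have h : a i `^ q <= K2.
    rewrite (le_trans _ haq)// (bigD1 i)//= lerDl sumr_ge0// => ? _; exact: powR_ge0.
  have -> : a i = (a i `^ q) `^ q^-1 by rewrite -powRrM divff ?gt_eqF// powRr1.
  by rewrite ge0_ler_powR ?nnegrE ?powR_ge0 ?invr_ge0// ltW.
have hap : \sum_(i < H) a i `^ p <= e * H%:R.
  apply: (@le_trans _ _ (\sum_(i < H) (eta `^ p + c * a i `^ q))).
    by apply: ler_sum => i _; exact: powR_split.
  have hc := le_trans (ler_wpM2l c0 haq) HH.
  rewrite big_split/= sumr_const card_ord etap -mulr_sumr.
  rewrite (_ : e * H%:R = (e / 2) *+ H + e / 2 * H%:R); first by rewrite lerD2l.
  by rewrite -[(e / 2) *+ H]mulr_natr; field.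
rewrite (_ : \sum_(i < H) _ = (\sum_(i < H) a i `^ p) * m).
  by rewrite ler_pM2r.
by rewrite mulr_suml; apply: eq_bigr => i _; rewrite ya (powRM p (a0 i) (ltW u0)) up.
Qed.

End cotype_gain.

(** * The UMD inequality for block means *)

Section uniform_nat.
Context {R : realType} (M : nat).
Let weight_ge0 : (0 <= M.+1%:R^-1 :> R)%R.
Proof. by rewrite invr_ge0. Qed.

Local Open Scope ereal_scope.

(** The uniform law on [M.+1] points, carried by [nat], where every set is measurable; all integrals
    become finite sums. *)
Definition uniform_nat : set nat -> \bar R :=
  mscale (NngNum weight_ge0) (msum (fun b => \d_b) M.+1).

HB.instance Definition _ := Measure.on uniform_nat.

Lemma uniform_natE (A : set nat) :
  uniform_nat A = (M.+1%:R^-1 * \sum_(b < M.+1) ((b : nat) \in A)%:R)%R%:E.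
Proof.
rewrite /uniform_nat /mscale /msum /= EFinM -sumEFin; congr (_ * _).
Qed.

Let uniform_nat_setT : uniform_nat setT = 1.
Proof.
rewrite uniform_natE; under eq_bigr do rewrite in_setT.
by rewrite sumr_const card_ord mulVf// pnatr_eq0.
Qed.

HB.instance Definition _ :=
  Measure_isProbability.Build _ _ R uniform_nat uniform_nat_setT.

Lemma integral_uniform_nat (f : nat -> R) : (forall b, 0 <= f b)%R ->
  \int[uniform_nat]_b (f b)%:E = (M.+1%:R^-1 * \sum_(b < M.+1) f b)%R%:E.
Proof.
move=> f0; rewrite /uniform_nat ge0_integral_mscale//=; last first.
  by move=> b _; rewrite lee_fin.
rewrite ge0_integral_measure_sum//; last by move=> b _; rewrite lee_fin.
rewrite EFinM -sumEFin; congr (_ * _); apply: eq_bigr => b _.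
by rewrite integral_dirac// diracT mul1e.
Qed.

End uniform_nat.

Section uniform_nat_vector.
Context {R : realType} {X : normedModType R[i]} (M : nat).
Let P : probability nat R := uniform_nat M.

Lemma simple_integral_uniform_nat (A : set nat) (s : nat -> X) :
  simple_integral P A s =
  (M.+1%:R^-1)%:C *: \sum_(b < M.+1 | (b : nat) \in A) s b.
Proof.
(* Values taken only beyond [M] have weight zero, so the sum over the range of [s] reduces to this
   list. *)
pose r := undup [seq s b | b <- iota 0 M.+1].
have mr b : (b < M.+1)%N -> s b \in r.
  by move=> bM; rewrite mem_undup map_f// mem_iota.
rewrite /simple_integral (fsbigE r) ?undup_uniq//; last 2 first.
- move=> x /=; rewrite mem_undup => /mapP[b _ ->]; by exists b.
- move=> x _ xr; rewrite /P/= uniform_natE/= big1 ?mulr0 ?scale0r// => b _.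
  rewrite memNset// => -[_ /= sx]; move: xr; rewrite -sx mr//.
transitivity (\sum_(x <- r) \sum_(b < M.+1 | (b : nat) \in A)
    (M.+1%:R^-1)%:C *: (if s b == x then x else 0)).
  rewrite big_seq_cond [RHS]big_seq_cond; apply: eq_big => x.
    case xr: (x \in r) => //=; apply/mem_set.
    move: xr; rewrite mem_undup => /mapP[b _ ->]; by exists b.
  move=> _; rewrite /P/= uniform_natE/= -scaler_sumr rmorphM/= -scalerA; congr (_ *: _).
  rewrite rmorph_sum/= scaler_suml [RHS]big_mkcond/=; apply: eq_bigr => b _.
  rewrite in_setI.
  have -> : ((b : nat) \in s @^-1` [set x]) = (s b == x).
    by apply/idP/eqP; rewrite inE.
  by case: (_ \in A); case: eqP => _; rewrite /= ?scale0r// scale1r.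
rewrite exchange_big/= scaler_sumr; apply: eq_bigr => b _.
rewrite -scaler_sumr; congr (_ *: _).
rewrite (bigD1_seq (s b)) ?undup_uniq ?mr//= eqxx big1 ?addr0// => x.
by rewrite eq_sym => /negPf ->.
Qed.

Lemma LpX_norm_uniform_nat (p : R) (f : nat -> X) : 1 < p ->
  LpX_norm P p f = ((M.+1%:R^-1 * \sum_(b < M.+1) rnorm (f b) `^ p) `^ p^-1)%:E.
Proof.
move=> p1; rewrite /LpX_norm unlock /=.
rewrite -poweR_EFin; congr poweR.
rewrite -(@integral_uniform_nat R M (fun b => rnorm (f b) `^ p)); last first.
  by move=> b; exact: powR_ge0.
apply: eq_integral => b _.
by rewrite /= ger0_norm ?rnorm_ge0.
Qed.

End uniform_nat_vector.

Section umd_blocks.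
Context {R : realType} {X : normedModType R[i]}.

Definition block_set (L : nat) : set (set nat) :=
  [set A | forall b b', (b %/ L = b' %/ L)%N -> A b -> A b'].

Lemma block_set_sigma_algebra L : sigma_algebra setT (block_set L).
Proof.
split.
- by move=> b b' _.
- by move=> A HA b b' bb'; rewrite setTD => h h'; apply: h; exact: (HA b').
- by move=> F HF b b' bb' [i _ Fi]; exists i => //; exact: (HF i b).
Qed.

Lemma dvdn_block (L L' b b' : nat) : (L %| L')%N ->
  (b %/ L = b' %/ L -> b %/ L' = b' %/ L')%N.
Proof. by move=> /dvdnP[k ->] h; rewrite mulnC !divnMA h. Qed.

(* The n-th sigma-algebra consists of the unions of blocks [a L_n, (a + 1) L_n);
   the probability is uniform on {0, ..., M - 1}. *)
Lemma umd_blocks : UMD X -> exists2 p : R, 1 < p & exists2 C : R, 0 < C &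
  forall (M N : nat) (L : nat -> nat) (D : nat -> nat -> X) (eps : nat -> bool),
  (0 < M)%N ->
  (forall n, (n <= N)%N -> (0 < L n)%N /\ (L n %| M)%N) ->
  (forall n, (n < N)%N -> (L n.+1 %| L n)%N) ->
  (forall n b b', (1 <= n <= N)%N ->
    (b %/ L n = b' %/ L n)%N -> D n b = D n b') ->
  (forall n a, (1 <= n <= N)%N ->
    \sum_(j < L n.-1) D n (a * L n.-1 + j)%N = 0) ->
  \sum_(b < M) rnorm (\sum_(1 <= n < N.+1) (-1) ^+ eps n *: D n b) `^ p <=
  C * \sum_(b < M) rnorm (\sum_(1 <= n < N.+1) D n b) `^ p.
Proof.
move=> [p [p1 [C [C0 umd]]]]; exists p => //; exists (C `^ p); first exact: powR_gt0.
have p0 : 0 < p by apply: lt_trans p1.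
move=> [//|M] N L D eps _ L0 LL Dc D0.
(* Cutting off beyond [M] makes the range finite. It respects the blocks because each [L n] divides
   [M.+1]. *)
pose D' n b := if (b < M.+1)%N then D n b else 0.
pose P : probability nat R := uniform_nat M.
have bM n b b' : (n <= N)%N -> (b %/ L n = b' %/ L n)%N -> (b < M.+1)%N = (b' < M.+1)%N.
  move=> nN h; have [l0 /dvdnP[k ->]] := L0 n nN.
  by rewrite -!ltn_divLR// h.
have D'c n b b' : (1 <= n <= N)%N -> (b %/ L n = b' %/ L n)%N -> D' n b = D' n b'.
  by move=> /[dup] /andP[_ nN] n1N h; rewrite /D' (bM n b b')// (Dc n b b').
have simp n : (1 <= n <= N)%N -> simple_fun (block_set (L n)) (D' n).
  move=> nN; split.
    pose r := 0 :: [seq D n b | b <- iota 0 M.+1].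
    apply: (@sub_finite_set _ _ [set` r]); last exact: finite_seq.
    move=> _ [b _ <-]; rewrite /D'; case: ifPn => h; last exact: mem_head.
    rewrite /mkset in_cons; apply/orP; right.
    by apply/mapP; exists b; rewrite // mem_iota.
  by move=> x b b' h /= <-; apply/esym/D'c.
have meas n (f : nat -> X) : simple_fun (block_set n) f -> simple_fun measurable f.
  by case=> ? ?; split.
have hmart : martingale_difference P p N (block_set \o L) D'.
  split.
    split; first by move=> n _; split; [exact: block_set_sigma_algebra|].
    move=> n nN A HA b b' h; apply: HA.
    by apply: dvdn_block h; exact: LL.
  move=> n nN1; have /andP[n1 nN] := nN1; split.
  - exists (fun=> D' n); split; first by move=> k; exact: simp.
    by move=> w; exact: cvg_cst.
  - by rewrite LpX_norm_uniform_nat// ltry.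
  - have nN' : (n.-1 <= N)%N by rewrite (leq_trans (leq_pred n)).
    have s0 : simple_fun (block_set (L n.-1)) (cst (0 : X)).
      split; last by move=> x b b' _.
      by apply: (@sub_finite_set _ _ [set 0]); [move=> _ [b _ <-]|exact: finite_set1].
    split.
      exists (fun=> cst 0); split => // w; exact: cvg_cst.
    (* A set of the coarser sigma-algebra is a union of blocks, and [D n] sums to zero over each of
       them. *)
    move=> A HA; exists 0.
    have gen (f : nat -> X) : simple_fun measurable f -> simple_integral P A f = 0 ->
        is_bochner_integral P A f 0.
      move=> sf f0; split; first by exists (fun=> f); split=> // w; exact: cvg_cst.
      exists (fun=> f); split => //.
        rewrite [X in X @ _ --> _](_ : _ = fun=> 0%E); first exact: cvg_cst.
        by apply/funext => k; apply: integral0_eq => w _; rewrite subrr rnorm0.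
      by rewrite f0; exact: cvg_cst.
    split; apply: gen.
    + by apply: (meas (L n)); exact: simp.
    + rewrite simple_integral_uniform_nat big_mkcond/=.
      have [l0 /dvdnP[k Mk]] := L0 _ nN'.
      rewrite -(big_mkord xpredT (fun b => if b \in A then D' n b else 0)) Mk.
      rewrite big_nat_mul/= big1_seq ?scaler0// => a /=; rewrite mem_index_iota/= => ak.
      transitivity (\sum_(j < L n.-1)
          (if (a * L n.-1)%N \in A then D n (a * L n.-1 + j)%N else 0)); last first.
        by case: ((a * L n.-1)%N \in A); [exact: D0|rewrite big1_eq].
      rewrite -{1}[(a * _)%N]add0n big_addn mulSn addnK big_mkord.
      apply: eq_bigr => j _; rewrite addnC.
      have hb : ((a * L n.-1 + j) %/ L n.-1 = (a * L n.-1) %/ L n.-1)%N.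
        by rewrite divnMDl// mulnK// divn_small// addn0.
      have -> : ((a * L n.-1 + j)%N \in A) = ((a * L n.-1)%N \in A).
        by apply/idP/idP; rewrite !inE; apply: HA.
      case: ifP => // _; rewrite /D' ifT// Mk -ltn_divLR// hb mulnK//.
    + by apply: (meas (L n.-1)).
    + by rewrite simple_integral_uniform_nat big1 ?scaler0.
have := umd _ _ P N _ D' eps hmart.
rewrite !LpX_norm_uniform_nat// -EFinM lee_fin => h.
have S0 (f : nat -> X) : 0 <= M.+1%:R^-1 * \sum_(b < M.+1) rnorm (f b) `^ p.
  by rewrite mulr_ge0 ?invr_ge0// sumr_ge0// => ? _; exact: powR_ge0.
have unroot (a b : R) : a `^ p^-1 <= C * b `^ p^-1 -> 0 <= a -> 0 <= b -> a <= C `^ p * b.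
  move=> ab a0 b0; have := ge0_ler_powR (ltW p0) _ _ ab.
  rewrite !nnegrE mulr_ge0 ?powR_ge0 ?(ltW C0)// => /(_ isT isT).
  by rewrite (powRM p (ltW C0) (powR_ge0 _ _)) -!powRrM mulVf ?gt_eqF// !powRr1.
have {h} := unroot _ _ h
  (S0 (fun b => \sum_(1 <= n < N.+1) (-1) ^+ eps n *: D' n b))
  (S0 (fun b => \sum_(1 <= n < N.+1) D' n b)).
rewrite mulrCA ler_pM2l ?invr_gt0 ?ltr0n//.
under eq_bigr => b _ do under eq_bigr do rewrite /D' ltn_ord.
by under [X in _ <= _ * X -> _]eq_bigr => b _ do under eq_bigr do rewrite /D' ltn_ord.
Qed.

End umd_blocks.

(** * Jensen's inequality and block means *)

Lemma jensen_powR {R : realType} (p : R) (L : nat) (a : nat -> R) : 1 < p -> (0 < L)%N ->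
  (forall j, 0 <= a j) ->
  L%:R * (L%:R^-1 * \sum_(j < L) a j) `^ p <= \sum_(j < L) a j `^ p.
Proof.
move=> p1 L0 a0; have p0 : 0 < p := lt_trans ltr01 p1.
have Lr : 0 < L%:R :> R by rewrite ltr0n.
set A := _ * \sum_(j < L) _.
have A0 : 0 <= A by rewrite mulr_ge0 ?invr_ge0 ?ler0n// sumr_ge0.
have sA : \sum_(j < L) a j = L%:R * A by rewrite /A mulrA divff ?mul1r// gt_eqF.
pose q := p / (p - 1).
have pB : 0 < p - 1 by rewrite subr_gt0.
have q0 : 0 < q by rewrite divr_gt0.
have pq : p^-1 + q^-1 = 1.
  by rewrite /q invf_div -[X in X + _]mul1r -mulrDl addrC subrK divff// gt_eqF.
have Aq : (A `^ (p - 1)) `^ q = A `^ p by rewrite -powRrM /q mulrC divfK// gt_eqF.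
have young j : a j * A `^ (p - 1) <= a j `^ p / p + A `^ p / q.
  by rewrite -Aq; exact: conjugate_powR (a0 j) (powR_ge0 _ _) p0 q0 pq.
have := ler_sum (index_enum _) (fun (j : 'I_L) (_ : true) => young j).
rewrite -mulr_suml sA -mulrA mulr_powRB1// big_split/= -mulr_suml sumr_const card_ord.
rewrite -[X in _ <= _ + X -> _]mulr_natl => h.
have Ap : A `^ p = A `^ p / p + A `^ p / q by rewrite -mulrDr pq mulr1.
have : L%:R * (A `^ p / p) <= (\sum_(j < L) a j `^ p) / p.
  by rewrite -(lerD2r (L%:R * (A `^ p / q))) -mulrDr -Ap.
by rewrite mulrA ler_pM2r// invr_gt0.
Qed.

Lemma sum_blocks (V : nmodType) (L M : nat) (F : nat -> V) :
  (0 < L)%N -> (L %| M)%N ->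
  \sum_(b < M) F b = \sum_(a < M %/ L) \sum_(j < L) F (a * L + j)%N.
Proof.
move=> L0 /dvdnP[k ->]; rewrite mulnK// -(big_mkord xpredT F) big_nat_mul/= big_mkord.
apply: eq_bigr => a _.
rewrite -{1}[(a * _)%N]add0n big_addn mulSn addnK big_mkord.
by apply: eq_bigr => j _; rewrite addnC.
Qed.

Section block_mean.
Context {R : realType} {X : normedModType R[i]}.
Implicit Types h k : nat -> X.

(** The conditional expectation of [h] given the blocks of length [L]. *)
Definition block_mean (L : nat) h (b : nat) : X :=
  (L%:R^-1 : R)%:C *: \sum_(j < L) h (b %/ L * L + j)%N.

Lemma rnorm_realZ (c : R) (x : X) : 0 <= c -> rnorm (c%:C *: x) = c * rnorm x.
Proof.
move=> c0; rewrite rnormZ; congr (_ * _); apply: complexI.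
by rewrite -rnormE ger0_norm// lecR.
Qed.

Lemma block_divn L a (j : 'I_L) : ((a * L + j) %/ L = a)%N.
Proof.
have L0 : (0 < L)%N by rewrite (leq_trans _ (ltn_ord j)).
by rewrite divnMDl// divn_small// addn0.
Qed.

Lemma block_mean_eq L h b b' : (b %/ L = b' %/ L)%N ->
  block_mean L h b = block_mean L h b'.
Proof. by rewrite /block_mean => ->. Qed.

Lemma sum_block_mean L h a : (0 < L)%N ->
  \sum_(j < L) block_mean L h (a * L + j)%N = \sum_(j < L) h (a * L + j)%N.
Proof.
move=> L0; under eq_bigr do rewrite /block_mean block_divn.
rewrite sumr_const card_ord -scaler_nat scalerA.
by rewrite rmorphV ?unitfE ?pnatr_eq0 -?lt0n//= rmorph_nat divff ?scale1r// pnatr_eq0 -lt0n.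
Qed.

(** The tower property; it makes successive differences of block means martingale differences. *)
Lemma sum_block_mean_sub L L' h a : (0 < L)%N -> (0 < L')%N -> (L' %| L)%N ->
  \sum_(j < L) (block_mean L' h (a * L + j)%N - block_mean L h (a * L + j)%N) = 0.
Proof.
move=> L0 L'0 L'L; rewrite sumrB sum_block_mean//.
rewrite (sum_blocks (fun j => block_mean L' h (a * L + j)%N) L'0 L'L).
rewrite (sum_blocks (fun j => h (a * L + j)%N) L'0 L'L).
apply/eqP; rewrite subr_eq0; apply/eqP; apply: eq_bigr => c _.
have [k Lk] := dvdnP L'L.
have E (c' j : nat) : (a * L + (c' * L' + j) = (a * k + c') * L' + j)%N.
  by rewrite Lk mulnDl -mulnA addnA.
under eq_bigr do rewrite E; under [RHS]eq_bigr do rewrite E.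
exact: sum_block_mean.
Qed.

Lemma block_mean_Lp (p : R) L M h : 1 < p -> (0 < L)%N -> (L %| M)%N ->
  \sum_(b < M) rnorm (block_mean L h b) `^ p <= \sum_(b < M) rnorm (h b) `^ p.
Proof.
move=> p1 L0 LM.
rewrite (sum_blocks (fun b => rnorm (block_mean L h b) `^ p) L0 LM).
rewrite (sum_blocks (fun b => rnorm (h b) `^ p) L0 LM).
apply: ler_sum => a _; under eq_bigr do rewrite /block_mean block_divn.
rewrite sumr_const card_ord -[leLHS]mulr_natl.
apply: le_trans (jensen_powR (a := fun j => rnorm (h (a * L + j)%N)) p1 L0 _); last first.
  by move=> j; exact: rnorm_ge0.
rewrite ler_wpM2l// ge0_ler_powR ?nnegrE ?rnorm_ge0 ?mulr_ge0 ?invr_ge0 ?sumr_ge0//.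
- by rewrite ltW// (lt_trans ltr01).
- by move=> *; exact: rnorm_ge0.
- by rewrite rnorm_realZ ?invr_ge0// ler_wpM2l ?invr_ge0// rnorm_sum.
Qed.

Lemma powRD_le (p a b : R) : 0 < p -> 0 <= a -> 0 <= b ->
  (a + b) `^ p <= 2 `^ p * (a `^ p + b `^ p).
Proof.
move=> p0 a0 b0; wlog ab : a b a0 b0 / a <= b.
  move=> W; have [h|h] := leP a b; first exact: W.
  by rewrite addrC [X in _ * X]addrC; apply: W => //; exact: ltW.
rewrite (@le_trans _ _ ((2 * b) `^ p))//.
  rewrite ge0_ler_powR ?nnegrE ?addr_ge0 ?mulr_ge0//; first exact: ltW.
  by rewrite mulr_natl mulr2n lerD2r.
by rewrite (powRM p (ler0n R 2) b0) ler_wpM2l ?powR_ge0// lerDr powR_ge0.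
Qed.

(* Average the UMD inequality over all choices of signs. *)
Lemma umd_cotype_gain (q : R) : UMD X -> 0 < q -> has_cotype X q ->
  exists2 p : R, 1 < p & forall e : R, 0 < e ->
  exists2 H : nat, (0 < H)%N & forall (M : nat) (L : nat -> nat) k,
  (0 < M)%N ->
  (forall n, (n <= H)%N -> (0 < L n)%N /\ (L n %| M)%N) ->
  (forall n, (n < H)%N -> (L n.+1 %| L n)%N) ->
  \sum_(i < H) \sum_(b < M)
     rnorm (block_mean (L i.+1) k b - block_mean (L i) k b) `^ p
  <= e * H%:R * \sum_(b < M) rnorm (k b) `^ p.
Proof.
move=> /umd_blocks[p p1 [C C0 umd]] q0 cot; exists p => // e e0.
have p0 : 0 < p := lt_trans ltr01 p1.
(* The UMD constant, the factor from [powRD_le], and the two block means that remain when the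
   increments telescope. *)
pose c := C * (2 `^ p * 2).
have c0 : 0 < c by rewrite !mulr_gt0// powR_gt0.
have [H [H0 gain]] := cotype_gain p0 q0 cot (divr_gt0 e0 c0).
exists H => // M L k M0 LM LL.
pose D n b := block_mean (L n) k b - block_mean (L n.-1) k b.
have Dsum b n : (n <= H)%N ->
    \sum_(1 <= i < n.+1) D i b = block_mean (L n) k b - block_mean (L 0) k b.
  by move=> _; rewrite big_add1/= telescope_sumr.
pose Sk := \sum_(b < M) rnorm (k b) `^ p.
have hs (s : {ffun 'I_H -> bool}) :
    \sum_(b < M) rnorm (\sum_(i < H) (-1) ^+ s i *: D i.+1 b) `^ p <= c * Sk.
  pose eps n := if insub n.-1 is Some i then s i else false.
  have E b : \sum_(i < H) (-1) ^+ s i *: D i.+1 b =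
             \sum_(1 <= n < H.+1) (-1) ^+ eps n *: D n b.
    rewrite big_add1/= big_mkord; apply: eq_bigr => i _.
    by rewrite /eps/= valK.
  under eq_bigr do rewrite E.
  apply: le_trans (umd M H L D eps M0 LM LL _ _) _.
  - move=> n b b' /andP[n1 nH] bb'; rewrite /D (block_mean_eq k bb').
    congr (_ - _); apply: block_mean_eq; apply: dvdn_block bb'.
    by case: n n1 nH => // n _ nH; exact: LL.
  - move=> n a /andP[n1 nH]; case: n n1 nH => // n _ nH /=.
    by apply: sum_block_mean_sub; [exact: (LM n (ltnW nH)).1|exact: (LM _ nH).1|exact: LL].
  rewrite /c -[leRHS]mulrA ler_pM2l//.
  under eq_bigr do rewrite Dsum//.
  have [L00 L0M] := LM 0 (leq0n _); have [LH0 LHM] := LM H (leqnn _).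
  apply: (@le_trans _ _ (\sum_(b < M) 2 `^ p * (rnorm (block_mean (L H) k b) `^ p
       + rnorm (block_mean (L 0) k b) `^ p))).
    apply: ler_sum => b _; apply: le_trans (powRD_le p0 (rnorm_ge0 _) (rnorm_ge0 _)).
    by rewrite ge0_ler_powR ?nnegrE ?addr_ge0 ?rnorm_ge0 ?rnormB// ltW.
  rewrite -mulr_sumr -[leRHS]mulrA ler_pM2l ?powR_gt0// big_split/= mulr_natl mulr2n.
  by apply: lerD; exact: block_mean_Lp.
rewrite exchange_big/=.
apply: (@le_trans _ _ (\sum_(b < M) e / c * H%:R *
   rademacher_mean (fun s => rnorm (\sum_(i < H) (-1) ^+ s i *: D i.+1 b) `^ p))).
  by apply: ler_sum => b _; exact: (gain (fun i => D i.+1 b)).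
rewrite -mulr_sumr /rademacher_mean -mulr_suml exchange_big/=.
have h2 : (0 : R) < 2 ^+ H by rewrite exprn_gt0.
have : \sum_(s : {ffun 'I_H -> bool}) \sum_(b < M)
    rnorm (\sum_(i < H) (-1) ^+ s i *: D i.+1 b) `^ p <= 2 ^+ H * (c * Sk).
  apply: le_trans (ler_sum _ (fun s _ => hs s)) _.
  by rewrite sumr_const card_ffun card_bool card_ord -[leLHS]mulr_natl natrX.
rewrite -[leRHS]mulrC -ler_pdivrMr// => h.
have ecH : 0 <= e / c * H%:R by rewrite mulr_ge0// divr_ge0// ltW.
apply: le_trans (ler_wpM2l ecH h) _.
have cn0 : c != 0 by rewrite gt_eqF.
by rewrite [leLHS](_ : _ = e * H%:R * Sk)//; move: cn0; clearbody c Sk => ?; field.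
Qed.

End block_mean.

(** * Resolvents on the unit circle *)

Section complex_modulus.
Context {R : realType}.
Implicit Types z w : R[i].

Definition cabs z : R := rnorm (z : R[i]^o).

Lemma cabsE z : `|z| = (cabs z)%:C.
Proof. exact: (@rnormE R R[i]^o z). Qed.

Lemma cabs_ge0 z : 0 <= cabs z.
Proof. exact: rnorm_ge0. Qed.

Lemma cabsM z w : cabs (z * w) = cabs z * cabs w.
Proof. by apply: complexI; rewrite rmorphM/= -!cabsE normrM. Qed.

Lemma cabs1 : cabs 1 = 1.
Proof. by apply: complexI; rewrite -cabsE normr1. Qed.

Lemma cabsX z n : cabs (z ^+ n) = cabs z ^+ n.
Proof. by elim: n => [|n IH]; rewrite ?expr0 ?cabs1// !exprS cabsM IH. Qed.

Lemma cabs_real (r : R) : 0 <= r -> cabs r%:C = r.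
Proof. by move=> r0; apply: complexI; rewrite -cabsE ger0_norm// lecR. Qed.

Lemma cabsV z : cabs z^-1 = (cabs z)^-1.
Proof. by apply: complexI; rewrite fmorphV/= -!cabsE normfV. Qed.

Lemma cabsD z w : cabs (z + w) <= cabs z + cabs w.
Proof. exact: (@rnormD R R[i]^o). Qed.

Lemma cabs_distC z w : cabs (z - w) = cabs (w - z).
Proof. by rewrite -opprB; exact: (@rnormN R R[i]^o). Qed.

Lemma cabs_sub1X z n : cabs z = 1 -> cabs (z ^+ n - 1) <= n%:R * cabs (z - 1).
Proof.
move=> z1; elim: n => [|n IH].
  by rewrite expr0 subrr mul0r /cabs rnorm0.
have -> : z ^+ n.+1 - 1 = z * (z ^+ n - 1) + (z - 1).
  by rewrite mulrBr mulr1 addrA subrK exprS.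
by rewrite (le_trans (cabsD _ _))// cabsM z1 mul1r -natr1 mulrDl mul1r lerD2r.
Qed.

Lemma rnorm_scale (X : normedModType R[i]) z (x : X) :
  rnorm (z *: x) = cabs z * rnorm x.
Proof. exact: rnormZ. Qed.

End complex_modulus.

Section resolvent.
Context {R : realType} {X : normedModType R[i]}.

(* res z = (1 - z T)^-1 for 0 < |z| < 1. *)
Definition is_resolvent (T : {linear X -> X}) (C : R) (res : R[i] -> X -> X) :=
  forall z, 0 < cabs z < 1 ->
  [/\ forall x, res z (x - z *: T x) = x,
      forall x, res z x - z *: T (res z x) = x,
      linear (res z) &
      forall x, rnorm (res z x) <= C / (1 - cabs z) * rnorm x].

(** Here [(1 - z T)^-1] is [z^-1] times the resolvent at [z^-1], which is why 0 is excluded. The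
    constant is raised by 1 so that powers of it can be compared. *)
Lemma kreiss_resolvent (T : {linear X -> X}) : kreiss_bounded T ->
  exists2 C : R, 1 <= C & exists res, is_resolvent T C res.
Proof.
move=> [C C0 K]; exists (C + 1); first by rewrite lerDr ltW.
have H z : exists f : X -> X, 0 < cabs z < 1 ->
  [/\ forall x, f (x - z *: T x) = x,
      forall x, f x - z *: T (f x) = x,
      linear f &
      forall x, rnorm (f x) <= (C + 1) / (1 - cabs z) * rnorm x].
  have [/andP[z0 z1]|] := boolP (0 < cabs z < 1); last by exists id.
  have zn0 : z != 0.
    by apply: contraTN z0 => /eqP ->; rewrite /cabs rnorm0 ltxx.
  have zV : 1 < rnorm (z^-1 : R[i]^o).
    by rewrite -/(cabs _) cabsV invf_gt1.
  have [S [cS SL SR Sn]] := K z^-1 zV.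
  exists (fun x => z^-1 *: S x) => _; split.
  - move=> x; have -> : x - z *: T x = z *: (z^-1 *: x - T x).
      by rewrite scalerBr scalerA mulfV// scale1r.
    by rewrite linearZ/= SL scalerA mulVf// scale1r.
  - move=> x; rewrite [T _]linearZ/= scalerA mulfV// scale1r.
    exact: SR.
  - by move=> a x y; rewrite linearP/= scalerDr !scalerA mulrC.
  - move=> x; rewrite rnorm_scale cabsV.
    rewrite (le_trans (ler_wpM2l _ (rnorm_opnorm _ cS)))// ?invr_ge0 ?cabs_ge0//.
    rewrite mulrA ler_wpM2r ?rnorm_ge0//.
    move: Sn; rewrite -/(cabs _) cabsV => Sn.
    rewrite (le_trans (ler_wpM2l _ Sn))// ?invr_ge0 ?cabs_ge0//.
    rewrite mulrCA -invfM mulrBr mulr1 divff ?gt_eqF//.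
    by rewrite ler_wpM2r ?lerDl// invr_ge0 subr_ge0 ltW.
have [f Hf] := choice H.
by exists f => z; exact: Hf.
Qed.

Context {T : {linear X -> X}} {C : R} {res : R[i] -> X -> X}.
Hypothesis HR : is_resolvent T C res.
Implicit Types (z w : R[i]) (x y : X).

Lemma resK z x : 0 < cabs z < 1 -> res z (x - z *: T x) = x.
Proof. by move=> /HR[]. Qed.

Lemma resKV z x : 0 < cabs z < 1 -> z *: T (res z x) = res z x - x.
Proof. by move=> /HR[_ h _ _]; rewrite -{3}(h x) subKr. Qed.

Lemma res_lin z : 0 < cabs z < 1 -> linear (res z).
Proof. by move=> /HR[]. Qed.

Lemma res_le z x : 0 < cabs z < 1 -> rnorm (res z x) <= C / (1 - cabs z) * rnorm x.
Proof. by move=> /HR[]. Qed.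

Lemma resD z x y : 0 < cabs z < 1 -> res z (x + y) = res z x + res z y.
Proof. by move=> /res_lin h; have := h 1 x y; rewrite !scale1r. Qed.

Lemma res0 z : 0 < cabs z < 1 -> res z 0 = 0.
Proof.
by move=> hz; apply: (addrI (res z 0)); rewrite -resD// !addr0.
Qed.

Lemma resZ z a x : 0 < cabs z < 1 -> res z (a *: x) = a *: res z x.
Proof.
by move=> hz; have := res_lin hz a x 0; rewrite (res0 hz) !addr0.
Qed.

Lemma resN z x : 0 < cabs z < 1 -> res z (- x) = - res z x.
Proof. by move=> hz; rewrite -scaleN1r resZ// scaleN1r. Qed.

Lemma resB z x y : 0 < cabs z < 1 -> res z (x - y) = res z x - res z y.
Proof. by move=> hz; rewrite resD// resN. Qed.

Lemma res_identity z w x : 0 < cabs z < 1 -> 0 < cabs w < 1 ->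
  res z x - res w x = (z - w) *: res z (T (res w x)).
Proof.
move=> hz hw; set y := res w x.
have -> : x = (y - z *: T y) + (z - w) *: T y.
  rewrite scalerBl addrA subrK; apply/esym/eqP; rewrite subr_eq.
  by rewrite resKV// addrC subrK.
by rewrite resD// resK// resZ// addrAC subrr add0r.
Qed.

(** The resolvent identity with [T] eliminated through [resKV]: a product of two resolvents is a
    combination of the two. *)
Lemma res_mul z w x : 0 < cabs z < 1 -> 0 < cabs w < 1 ->
  (z - w) *: res w (res z x) = z *: res z x - w *: res w x.
Proof.
move=> hz hw.
have h := res_identity x hw hz.
have : z *: (res w x - res z x) = (w - z) *: (res w (res z x) - res w x).
  by rewrite h scalerA mulrC -scalerA -resZ// resKV// resB.
rewrite !scalerBr !scalerBl.
have move_terms (a b c d e : X) : e - c = (b - a) - (d - e) -> a - b = c - d.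
  move=> /(canLR (subrK _)) h2; rewrite -[LHS]opprB -[RHS]opprB -h2.
  by rewrite addrC addrA subrK.
exact: move_terms.
Qed.

End resolvent.

(** * Points of the unit circle *)

Section unit_circle.
Context {R : realType}.

Definition cis (t : R) : R[i] := (cos t +i* sin t)%C.

Lemma cisD (s t : R) : cis (s + t) = cis s * cis t.
Proof. by rewrite /cis cosD sinD; apply/eqP; rewrite eq_complex/= eqxx addrC/= eqxx. Qed.

Lemma cisX (t : R) n : cis t ^+ n = cis (n%:R * t).
Proof.
elim: n => [|n IH]; first by rewrite expr0 mul0r /cis cos0 sin0.
by rewrite exprS IH -cisD -natr1 mulrDl mul1r addrC.
Qed.

Lemma cabs_sqr (z : R[i]) : cabs z ^+ 2 = complex.Re z ^+ 2 + complex.Im z ^+ 2.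
Proof.
case: z => a b; rewrite /cabs /rnorm normc_def/= sqr_sqrtr//.
by rewrite addr_ge0 ?sqr_ge0.
Qed.

Lemma cabs_cis t : cabs (cis t) = 1.
Proof.
apply/eqP; rewrite -(@eqrXn2 _ 2) ?cabs_ge0// cabs_sqr/= cos2Dsin2.
by rewrite expr1n.
Qed.

Lemma sin_le_id (x : R) : 0 <= x -> sin x <= x.
Proof.
rewrite le_eqVlt => /predU1P[<-|x0]; first by rewrite sin0.
have [c _] := @MVT_segment R sin cos 0 x (ltW x0)
  (fun y _ => is_derive_sin y) (continuous_subspaceT (@continuous_sin R)).
rewrite sin0 !subr0 => ->.
by rewrite ler_piMl ?cos_le1// ltW.
Qed.

(** The chord has length [2 * sin (t / 2)]. *)
Lemma cabs_cis_sub1 t : 0 <= t <= pi -> cabs (cis t - 1) <= t.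
Proof.
move=> /andP[t0 tpi].
rewrite -(@ler_pXn2r _ 2) ?nnegrE ?cabs_ge0// cabs_sqr/= subr0.
have tt : t = t / 2 + t / 2 by field.
have s0 : 0 <= sin (t / 2).
  by apply: sin_ge0_pi; rewrite divr_ge0//= ler_pdivrMr//; lra.
have st : sin (t / 2) <= t / 2 by apply: sin_le_id; rewrite divr_ge0.
have -> : (cos t - 1) ^+ 2 + sin t ^+ 2 = (2 * sin (t / 2)) ^+ 2.
  have h1 := cos2Dsin2 t; have h2 := cos2Dsin2 (t / 2).
  have h3 : cos t = cos (t / 2) ^+ 2 - sin (t / 2) ^+ 2.
    by rewrite {1}tt cosD !expr2.
  by lra.
by rewrite lerXn2r ?nnegrE ?mulr_ge0//; lra.
Qed.

(** The point of angle [pi / 2 ^ m], a primitive root of order [2 ^ m.+1]; the constant 4 bounds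
    [pi]. *)
Lemma root_of_unity m : exists w : R[i],
  [/\ cabs w = 1, w ^+ (2 ^ m) = -1 & cabs (w - 1) <= 4 / (2 ^ m)%:R].
Proof.
have M0 : 0 < (2 ^ m)%:R :> R by rewrite ltr0n expn_gt0.
exists (cis (pi / (2 ^ m)%:R)); split; first exact: cabs_cis.
  rewrite cisX mulrC divfK ?gt_eqF// /cis cospi sinpi.
  by apply/eqP; rewrite eq_complex/= oppr0 !eqxx.
have p0 := @pi_ge0 R.
rewrite (le_trans (cabs_cis_sub1 _))//.
  apply/andP; split; first by rewrite divr_ge0// ltW.
  by rewrite ler_pdivrMr// ler_peMr// ler1n expn_gt0.
rewrite ler_wpM2r ?invr_ge0 ?(ltW M0)//.
by have := @pihalf_lt2 R; lra.
Qed.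

End unit_circle.

(** * Normalized resolvents *)

Section normalized_resolvent.
Context {R : realType} {X : normedModType R[i]} {T : {linear X -> X}} {C tau : R}
  {res : R[i] -> X -> X}.
Hypothesis HR : is_resolvent T C res.
Hypothesis C1 : 1 <= C.
Hypothesis tau0 : 0 <= tau.
Hypothesis Ttau : forall x, rnorm (T x) <= tau * rnorm x.
Implicit Types (N : R) (l w : R[i]) (x y : X).

Let C0 : 0 <= C := le_trans ler01 C1.

(* N^-1 (1 - z T)^-1 at z = (1 - 1/N) l, which is bounded by C when |l| = 1. *)
Definition nres N l x : X := (N^-1)%:C *: res ((1 - N^-1)%:C * l) x.

Lemma nres_dom N l : 1 < N -> cabs l = 1 ->
  cabs ((1 - N^-1)%:C * l) = 1 - N^-1 /\ 0 < 1 - N^-1 < 1.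
Proof.
move=> N1 l1; have h : 0 < 1 - N^-1 < 1.
  rewrite subr_gt0 invf_lt1 ?(lt_trans ltr01)// N1/= ltrBlDr ltrDl invr_gt0.
  exact: lt_trans N1.
by have /andP[h0 _] := h; rewrite cabsM l1 mulr1 cabs_real ?ltW.
Qed.

Let dom N l : 1 < N -> cabs l = 1 -> 0 < cabs ((1 - N^-1)%:C * l) < 1.
Proof. by move=> N1 l1; have [-> ->] := nres_dom N1 l1. Qed.

Lemma res_bound N l x : 1 < N -> cabs l = 1 ->
  rnorm (res ((1 - N^-1)%:C * l) x) <= C * N * rnorm x.
Proof.
move=> N1 l1; have [E _] := nres_dom N1 l1.
by have := res_le HR x (dom N1 l1); rewrite E subKr invrK.
Qed.

Lemma nres_le N l x : 1 < N -> cabs l = 1 -> rnorm (nres N l x) <= C * rnorm x.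
Proof.
move=> N1 l1; have N0 : 0 < N := lt_trans ltr01 N1.
rewrite /nres rnorm_realZ ?invr_ge0 ?(ltW N0)// [leLHS]mulrC ler_pdivrMr//.
by rewrite mulrAC; exact: res_bound.
Qed.

Lemma nresD N l x y : 1 < N -> cabs l = 1 ->
  nres N l (x + y) = nres N l x + nres N l y.
Proof. by move=> N1 l1; rewrite /nres (resD HR)// ?dom// scalerDr. Qed.

Lemma nresB N l x y : 1 < N -> cabs l = 1 ->
  nres N l (x - y) = nres N l x - nres N l y.
Proof. by move=> N1 l1; rewrite /nres (resB HR)// ?dom// scalerBr. Qed.

Lemma nres_sum N l (I : Type) (r : seq I) (F : I -> X) : 1 < N -> cabs l = 1 ->
  nres N l (\sum_(i <- r) F i) = \sum_(i <- r) nres N l (F i).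
Proof.
move=> N1 l1; elim: r => [|i r IH]; last by rewrite !big_cons nresD// IH.
by rewrite !big_nil /nres (res0 HR)// ?dom// scaler0.
Qed.

(** The resolvent identity produces two factors [C * N], one of which loses its [N] to the
    normalization. Hence [nres N] is nearly constant on arcs much shorter than [1 / N]. *)
Lemma nres_lipschitz N l w x : 1 < N -> cabs l = 1 -> cabs w = 1 ->
  rnorm (nres N l x - nres N w x) <= C ^+ 2 * tau * N * cabs (l - w) * rnorm x.
Proof.
move=> N1 l1 w1; have N0 : 0 < N := lt_trans ltr01 N1.
have [_ /andP[r0 r1]] := nres_dom N1 l1.
rewrite /nres -scalerBr rnorm_realZ ?invr_ge0 ?(ltW N0)//.
rewrite (res_identity HR)// ?dom// -mulrBr rnorm_scale cabsM cabs_real ?(ltW r0)//.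
rewrite [leLHS]mulrC ler_pdivrMr//.
have h : rnorm (res ((1 - N^-1)%:C * l) (T (res ((1 - N^-1)%:C * w) x))) <=
    C * N * (tau * (C * N * rnorm x)).
  rewrite (le_trans (res_bound _ N1 l1))// ler_wpM2l ?mulr_ge0 ?(ltW N0)//.
  by rewrite (le_trans (Ttau _))// ler_wpM2l// res_bound.
rewrite [leRHS](_ : _ = cabs (l - w) * (C * N * (tau * (C * N * rnorm x)))); last by ring.
rewrite ler_pM ?mulr_ge0 ?cabs_ge0 ?rnorm_ge0 ?(ltW r0)//.
by rewrite ler_piMl ?cabs_ge0// ltW.
Qed.

Lemma nres2_lipschitz N l w x : 1 < N -> cabs l = 1 -> cabs w = 1 ->
  rnorm (nres N l (nres N l x) - nres N w (nres N w x)) <=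
  2 * C ^+ 3 * tau * N * cabs (l - w) * rnorm x.
Proof.
move=> N1 l1 w1; have N0 : 0 < N := lt_trans ltr01 N1.
set k := C ^+ 2 * tau * N * cabs (l - w).
have k0 : 0 <= k by rewrite !mulr_ge0 ?exprn_ge0 ?cabs_ge0// ltW.
have -> : nres N l (nres N l x) - nres N w (nres N w x) =
    nres N l (nres N l x - nres N w x) +
    (nres N l (nres N w x) - nres N w (nres N w x)).
  by rewrite nresB// addrA subrK.
rewrite (le_trans (rnormD _ _))//.
have h1 : rnorm (nres N l (nres N l x - nres N w x)) <= C * (k * rnorm x).
  by rewrite (le_trans (nres_le _ N1 l1))// ler_wpM2l// nres_lipschitz.
have h2 : rnorm (nres N l (nres N w x) - nres N w (nres N w x)) <= k * (C * rnorm x).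
  by rewrite (le_trans (nres_lipschitz _ N1 l1 w1))// ler_wpM2l// nres_le.
rewrite (le_trans (lerD h1 h2))// le_eqVlt; apply/orP; left; apply/eqP.
by rewrite /k; ring.
Qed.

(** With [u] and [u'] at scales [N] and [N'], [res_mul] reads
    [(N - N') (u' u - u) = (N' - 1) (u - u')], and [N - N'] is at least [N / 2]. So [u'] is nearly
    the identity on the range of [u]. *)
Lemma nres_mul N N' l x : 1 < N' -> 2 * N' <= N -> cabs l = 1 ->
  rnorm (nres N' l (nres N l x) - nres N l x) <= 4 * C * (N' / N) * rnorm x.
Proof.
move=> N'1 NN l1; have N'0 : 0 < N' := lt_trans ltr01 N'1.
have N1 : 1 < N by lra.
have N0 : 0 < N := lt_trans ltr01 N1.
have d0 : 0 < N - N' by lra.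
have E : (N - N')%:C *: (nres N' l (nres N l x) - nres N l x) =
    (N' - 1)%:C *: (nres N l x - nres N' l x).
  have := res_mul HR x (dom N1 l1) (dom N'1 l1).
  set a := res _ x; set b := res _ x; set c := res _ a => h.
  have ln0 : l != 0 by apply: contra_eq_neq l1 => ->; rewrite /cabs rnorm0 eq_sym oner_neq0.
  have {}h : (1 - N^-1 - (1 - N'^-1))%:C *: c = (1 - N^-1)%:C *: a - (1 - N'^-1)%:C *: b.
    apply: (scalerI ln0); rewrite scalerBr !scalerA.
    by rewrite ![l * _]mulrC -h rmorphB/= mulrBl.
  have ca : nres N' l (nres N l x) = ((N^-1)%:C * (N'^-1)%:C) *: c.
    by rewrite /nres (resZ HR) ?dom// scalerA mulrC.
  rewrite ca [nres N l x]/(_ *: a) [nres N' l x]/(_ *: b).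
  rewrite !scalerBr !scalerA -!rmorphM/=.
  have -> : (N - N') * (N^-1 * N'^-1) = 1 - N^-1 - (1 - N'^-1).
    by field; rewrite !gt_eqF.
  rewrite h -addrA [- _ - _]addrC addrA; congr (_ - _).
    by rewrite -scalerBl -rmorphB/=; congr (_ *: _); congr (_%:C); field; rewrite gt_eqF.
  by congr (_ *: _); congr (_%:C); field; rewrite gt_eqF.
have h : (N - N') * rnorm (nres N' l (nres N l x) - nres N l x) <=
    (N' - 1) * (C * rnorm x + C * rnorm x).
  rewrite -rnorm_realZ ?(ltW d0)// E rnorm_realZ ?subr_ge0 ?(ltW N'1)//.
  by rewrite ler_wpM2l ?subr_ge0 ?(ltW N'1)// (le_trans (rnormB _ _))// lerD// nres_le.
rewrite -(ler_pM2l d0) (le_trans h)//.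
have x0 := rnorm_ge0 x.
have Cx : 0 <= C * rnorm x by rewrite mulr_ge0.
rewrite [leRHS](_ : _ = (C * rnorm x) * (4 * N' * (1 - N' / N))); last by field; rewrite gt_eqF.
rewrite [leLHS](_ : _ = (C * rnorm x) * (2 * (N' - 1))); last by ring.
rewrite ler_wpM2l//.
have : N' / N <= 1 / 2 by rewrite ler_pdivrMr//; lra.
by move=> h2; have := ler_wpM2l (ltW N'0) h2; nra.
Qed.

Lemma nres2_mul N N' l x : 1 < N' -> 2 * N' <= N -> cabs l = 1 ->
  rnorm (nres N' l (nres N' l (nres N l (nres N l x))) - nres N l (nres N l x))
  <= 8 * C ^+ 3 * (N' / N) * rnorm x.
Proof.
move=> N'1 NN l1; have N1 : 1 < N by lra.
set u := nres N l; set u' := nres N' l.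
have N'0 : 0 < N' := lt_trans ltr01 N'1; have N0 : 0 < N := lt_trans ltr01 N1.
have -> : u' (u' (u (u x))) - u (u x) =
    u' (u' (u (u x)) - u (u x)) + (u' (u (u x)) - u (u x)).
  by rewrite /u' nresB// addrA subrK.
set k := 4 * C * (N' / N).
have k0 : 0 <= k by rewrite !mulr_ge0 ?invr_ge0// ltW.
have h : rnorm (u' (u (u x)) - u (u x)) <= k * (C * rnorm x).
  by rewrite (le_trans (nres_mul _ N'1 NN l1))// ler_wpM2l// nres_le.
have h' := le_trans (nres_le _ N'1 l1) (ler_wpM2l C0 h).
rewrite (le_trans (rnormD _ _))// (le_trans (lerD h' h))//.
have C2 : C <= C ^+ 2 by rewrite expr2 ler_peMl.
have nn : 0 <= 4 * (N' / N) * C * rnorm x by rewrite !mulr_ge0 ?invr_ge0 ?rnorm_ge0// ltW.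
rewrite [leRHS](_ : _ = (4 * (N' / N) * C * rnorm x) * (C ^+ 2 + C ^+ 2)); last by ring.
rewrite [leLHS](_ : _ = (4 * (N' / N) * C * rnorm x) * (C ^+ 2 + C)); last by rewrite /k; ring.
by rewrite ler_wpM2l// lerD2l.
Qed.

Section blocks.
(** The powers of [w] move along the circle in steps comparable to [1 / M]; later [w] is a primitive
    [M]-th root of unity. *)
Variables (w : R[i]) (M : nat).
Hypothesis w1 : cabs w = 1.
Hypothesis wM : cabs (w - 1) <= 8 / M%:R.
Hypothesis wM' : 4 / M%:R <= cabs (w - 1).
Hypothesis M0 : (0 < M)%N.

Lemma cabs_rootX n : cabs (w ^+ n) = 1.
Proof. by rewrite cabsX w1 expr1n. Qed.
Let wX := cabs_rootX.

(** A discrete form of the fact that the square of a resolvent is nearly a derivative: the product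
    at neighbouring points is a difference quotient. *)
Lemma nres_telescope N n x : 1 < N ->
  ((1 - w) * N%:C) *: nres N (w ^+ n.+1) (nres N (w ^+ n) x) =
  nres N (w ^+ n) x - w *: nres N (w ^+ n.+1) x.
Proof.
move=> N1; have N0 : 0 < N := lt_trans ltr01 N1.
have := res_mul HR x (dom N1 (wX n)) (dom N1 (wX n.+1)).
set a := res _ x; set b := res _ x; set c := res _ a => h.
have [_ /andP[r0 _]] := nres_dom N1 (wX n).
have rn0 : (1 - N^-1)%:C * w ^+ n != 0.
  rewrite mulf_neq0//; first by rewrite gt_eqF// ltcR.
  apply/eqP => wn0; have /eqP := wX n.
  by rewrite wn0 /cabs rnorm0 eq_sym oner_eq0.
have {}h : (1 - w) *: c = a - w *: b.
  have zw : (1 - N^-1)%:C * w ^+ n.+1 = ((1 - N^-1)%:C * w ^+ n) * w.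
    by rewrite exprSr mulrA.
  apply: (scalerI rn0); rewrite scalerBr !scalerA -zw -h; congr (_ *: _).
  by rewrite zw mulrBr mulr1.
have ca : nres N (w ^+ n.+1) (nres N (w ^+ n) x) = ((N^-1)%:C * (N^-1)%:C) *: c.
  by rewrite /nres (resZ HR) ?dom// scalerA.
rewrite ca [nres N (w ^+ n) x]/(_ *: a) [nres N (w ^+ n.+1) x]/(_ *: b).
rewrite [RHS](_ : _ = (N^-1)%:C *: (a - w *: b)).
  rewrite -h !scalerA; congr (_ *: _).
  have NN : N%:C * (N^-1)%:C = 1 by rewrite -rmorphM/= divff ?gt_eqF.
  by rewrite mulrA -[_ * N%:C * _]mulrA NN mulr1 mulrC.
by rewrite scalerBr !scalerA mulrC.
Qed.

(** Squares are replaced by products at neighbouring points, which telescope. The three terms come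
    from the endpoints, from the factor [w] in [nres_telescope], and from the replacement. *)
Lemma nres2_block N s L x : 1 < N ->
  rnorm (\sum_(j < L) nres N (w ^+ (s + j)) (nres N (w ^+ (s + j)) x)) <=
  C * (M%:R / (2 * N) + L%:R / N + 8 * C ^+ 2 * tau * L%:R * (N / M%:R)) * rnorm x.
Proof.
move=> N1; have N0 : 0 < N := lt_trans ltr01 N1.
have Mr : 0 < M%:R :> R by rewrite ltr0n.
have x0 := rnorm_ge0 x.
have Cx : 0 <= C * rnorm x by rewrite mulr_ge0.
have d0 : 0 < cabs (w - 1) by rewrite (lt_le_trans _ wM')// divr_gt0.
pose u n := nres N (w ^+ n) x.
pose v n := nres N (w ^+ n.+1) (nres N (w ^+ n) x).
have tele : ((1 - w) * N%:C) *: (\sum_(j < L) v (s + j)%N) =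
    u s - u (s + L)%N + (1 - w) *: \sum_(j < L) u (s + j).+1.
  rewrite !scaler_sumr; under eq_bigr do rewrite /v nres_telescope//.
  elim: L => [|L IH]; first by rewrite !big_ord0 addn0 subrr addr0.
  rewrite !big_ord_recr/= IH -/(u _) -/(u _) addnS scalerBl scale1r.
  by rewrite [u s - _ + _]addrAC addrA subrK [RHS]addrACA addKr.
have hv : rnorm (\sum_(j < L) v (s + j)%N) <= (M%:R / (2 * N) + L%:R / N) * (C * rnorm x).
  have : cabs (w - 1) * N * rnorm (\sum_(j < L) v (s + j)%N) <=
     C * rnorm x + C * rnorm x + cabs (w - 1) * (L%:R * (C * rnorm x)).
    have -> : cabs (w - 1) * N = cabs ((1 - w) * N%:C).
      by rewrite cabsM cabs_distC cabs_real// ltW.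
    rewrite -rnorm_scale tele (le_trans (rnormD _ _))// lerD//.
      by rewrite (le_trans (rnormB _ _))// lerD// nres_le.
    rewrite rnorm_scale cabs_distC ler_wpM2l ?cabs_ge0//.
    rewrite (le_trans (rnorm_sum _ _ _))//.
    rewrite (_ : L%:R * _ = \sum_(j < L) (C * rnorm x)); last first.
      by rewrite sumr_const card_ord mulr_natl.
    by apply: ler_sum => j _; exact: nres_le.
  set S := rnorm (\sum_(j < L) _); set d := cabs (w - 1) => h.
  have dN : 0 < d * N by rewrite mulr_gt0.
  rewrite -(ler_pM2l dN) (le_trans h)//.
  rewrite [leRHS](_ : _ = (C * rnorm x) * (d * M%:R / 2 + d * L%:R)); last first.
    by field; rewrite gt_eqF.
  rewrite [leLHS](_ : _ = (C * rnorm x) * (2 + d * L%:R)); last by ring.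
  rewrite ler_wpM2l// lerD2r ler_pdivlMr// -ler_pdivrMr//.
  by rewrite (_ : 2 * 2 = 4) -?natrM.
pose k := 8 * C ^+ 3 * tau * (N / M%:R).
have hd n : rnorm (nres N (w ^+ n) (nres N (w ^+ n) x) - v n) <= k * rnorm x.
  rewrite (le_trans (nres_lipschitz _ N1 (wX _) (wX _)))//.
  have -> : cabs (w ^+ n - w ^+ n.+1) = cabs (w - 1).
    rewrite exprSr -{1}[w ^+ n]mulr1 -mulrBr cabsM wX mul1r.
    exact: cabs_distC.
  have hC := nres_le x N1 (wX n).
  have t0 : 0 <= C ^+ 2 * tau * N by rewrite !mulr_ge0 ?exprn_ge0// ltW.
  have := ler_wpM2l t0 wM => hw.
  apply: (@le_trans _ _ (C ^+ 2 * tau * N * (8 / M%:R) * (C * rnorm x))).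
    by apply: ler_pM => //; rewrite ?mulr_ge0 ?cabs_ge0 ?rnorm_ge0 ?exprn_ge0// ltW.
  by rewrite le_eqVlt; apply/orP; left; apply/eqP; rewrite /k; ring.
rewrite (_ : \sum_(j < L) _ = \sum_(j < L) v (s + j)%N +
  \sum_(j < L) (nres N (w ^+ (s + j)) (nres N (w ^+ (s + j)) x) - v (s + j)%N)); last first.
  by rewrite -big_split/=; apply: eq_bigr => j _; rewrite addrC subrK.
rewrite (le_trans (rnormD _ _))//.
have hs : rnorm (\sum_(j < L) (nres N (w ^+ (s + j)) (nres N (w ^+ (s + j)) x) - v (s + j)%N))
    <= L%:R * (k * rnorm x).
  rewrite (le_trans (rnorm_sum _ _ _))//.
  rewrite (_ : L%:R * _ = \sum_(j < L) (k * rnorm x)); last first.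
    by rewrite sumr_const card_ord mulr_natl.
  by apply: ler_sum.
rewrite (le_trans (lerD hv hs))// le_eqVlt; apply/orP; left; apply/eqP.
by rewrite /k; ring.
Qed.

(* On a block the squares are almost constant, so that the average does not
   see the oscillation of h around its block means. *)
Lemma nres2_oscillation N a L (y : nat -> X) : 1 < N -> (0 < L)%N ->
  \sum_(j < L) y (a * L + j)%N = 0 ->
  rnorm (\sum_(j < L) nres N (w ^+ (a * L + j)) (nres N (w ^+ (a * L + j)) (y (a * L + j)%N)))
  <= 16 * C ^+ 3 * tau * (N * L%:R / M%:R) * \sum_(j < L) rnorm (y (a * L + j)%N).
Proof.
move=> N1 L0 ys0; have N0 : 0 < N := lt_trans ltr01 N1.
have Mr : 0 < M%:R :> R by rewrite ltr0n.
pose u n x := nres N (w ^+ n) (nres N (w ^+ n) x).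
have -> : \sum_(j < L) nres N (w ^+ (a * L + j)) (nres N (w ^+ (a * L + j)) (y (a * L + j)%N)) =
   \sum_(j < L) (u (a * L + j)%N (y (a * L + j)%N) - u (a * L)%N (y (a * L + j)%N)).
  rewrite sumrB -[\sum_(i < L) u (a * L)%N _](nres_sum _ (fun j : 'I_L => nres N (w ^+ (a * L)) (y (a * L + j)%N)) N1 (wX _)).
  rewrite -nres_sum// ys0.
  by rewrite /nres (res0 HR) ?dom// scaler0 (res0 HR) ?dom// scaler0 subr0.
rewrite (le_trans (rnorm_sum _ _ _))// mulr_sumr ler_sum// => j _.
rewrite (le_trans (nres2_lipschitz _ N1 (wX _) (wX _)))// ler_wpM2r ?rnorm_ge0//.
have h : cabs (w ^+ (a * L + j) - w ^+ (a * L)) <= L%:R * (8 / M%:R).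
  rewrite exprD -{2}[w ^+ (a * L)]mulr1 -mulrBr cabsM wX mul1r.
  rewrite (le_trans (cabs_sub1X _ w1))// ler_pM ?cabs_ge0//.
  by rewrite ler_nat ltnW.
have k0 : 0 <= 2 * C ^+ 3 * tau * N by rewrite !mulr_ge0 ?exprn_ge0// ltW.
rewrite (le_trans (ler_wpM2l k0 h))// le_eqVlt; apply/orP; left; apply/eqP.
by ring.
Qed.

End blocks.
End normalized_resolvent.

Arguments nres {R X} res N l x.

(** * Decay of square means *)

Lemma powR_le_inv {R : realType} (p a b : R) : 0 < p -> 0 <= a -> 0 <= b ->
  a `^ p <= b `^ p -> a <= b.
Proof.
move=> p0 a0 b0; apply: contraTT; rewrite -!ltNge => ba.
by apply: gt0_ltr_powR; rewrite ?nnegrE.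
Qed.

Section Lp_mean.
Context {R : realType} {X : normedModType R[i]}.

Lemma Lp_L1 (p Lam : R) M (a : nat -> R) : 1 < p -> (0 < M)%N -> 0 <= Lam ->
  (forall b, 0 <= a b) -> \sum_(b < M) a b `^ p <= M%:R * Lam `^ p ->
  \sum_(b < M) a b <= M%:R * Lam.
Proof.
move=> p1 M0 L0 a0 h; have Mr : 0 < M%:R :> R by rewrite ltr0n.
have p0 : 0 < p := lt_trans ltr01 p1.
have := le_trans (jensen_powR p1 M0 a0) h; rewrite ler_pM2l// => h2.
rewrite -ler_pdivrMl//; apply: powR_le_inv h2 => //.
by rewrite mulr_ge0 ?invr_ge0 ?(ltW Mr)// sumr_ge0.
Qed.

Lemma block_mean_L1 L M (h : nat -> X) : (0 < L)%N -> (L %| M)%N ->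
  \sum_(b < M) rnorm (block_mean L h b) <= \sum_(b < M) rnorm (h b).
Proof.
move=> L0 LM; have Lr : 0 < L%:R :> R by rewrite ltr0n.
rewrite (sum_blocks (fun b => rnorm (block_mean L h b)) L0 LM).
rewrite (sum_blocks (fun b => rnorm (h b)) L0 LM).
apply: ler_sum => a _; under eq_bigr do rewrite /block_mean block_divn.
rewrite sumr_const card_ord -[leLHS]mulr_natl rnorm_realZ ?invr_ge0 ?(ltW Lr)//.
by rewrite mulrA divff ?gt_eqF// mul1r rnorm_sum.
Qed.

End Lp_mean.

(** Exponents of 2 for [square_mean_step]: the scale [2 ^+ a] lies [g] binary digits from the
    frequencies of the two neighbouring block lengths, so each ratio in [one_scale] is at most
    [2^-1 ^+ g]. *)
Lemma scale_exponents (g l i H m : nat) : (0 < g)%N -> (i < H)%N ->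
  (2 * g * (l + H) + g <= m)%N ->
  let a := (2 * g * (l + i.+1))%N in let c := (2 * g * (l + H).+1)%N in
  [/\ (a.+1 <= c)%N, (a + g <= c)%N, (a + (m - (a + g)) + g <= m)%N,
      (m + g <= m - (2 * g * (l + i) + g) + a)%N & (0 + g <= a)%N /\ (a + g <= m)%N].
Proof.
move=> g0 iH gm a c.
have am : (a <= 2 * g * (l + H))%N by rewrite leq_mul2l leq_add2l iH orbT.
have ei : (a = 2 * g * (l + i) + g + g)%N.
  by rewrite /a addnS mulnS addnC mul2n -addnn addnA.
have ec : (c = 2 * g * (l + H) + g + g)%N.
  by rewrite /c mulnS addnC mul2n -addnn addnA.
move: am ei ec; set b := (2 * g * (l + i))%N; set d := (2 * g * (l + H))%N in gm *.
by move: a b c d gm => a b c d gm am ei ec; split; lia.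
Qed.

Section scales.
Context {R : realType} {X : normedModType R[i]} {T : {linear X -> X}} {C tau : R}
  {res : R[i] -> X -> X}.
Hypothesis HR : is_resolvent T C res.
Hypothesis C1 : 1 <= C.
Hypothesis tau0 : 0 <= tau.
Hypothesis Ttau : forall x, rnorm (T x) <= tau * rnorm x.
Variables (w : R[i]) (M : nat) (p : R).
Hypothesis w1 : cabs w = 1.
Hypothesis wM : cabs (w - 1) <= 8 / M%:R.
Hypothesis wM' : 4 / M%:R <= cabs (w - 1).
Hypothesis M0 : (0 < M)%N.
Hypothesis p1 : 1 < p.

Let C0 : 0 <= C := le_trans ler01 C1.
Let Mr : 0 < M%:R :> R. Proof. by rewrite ltr0n. Qed.
Let p0 : 0 < p := lt_trans ltr01 p1.

Local Notation U N b x := (nres res N (w ^+ b) (nres res N (w ^+ b) x)).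

(** In the notation of the introduction, [beta] bounds beta_N. The majorant [Lam] stands for the
    normalized L^p norm of [h], which avoids p-th roots. *)
Definition square_mean_le (N beta : R) := forall (h : nat -> X) (Lam : R),
  0 <= Lam -> \sum_(b < M) rnorm (h b) `^ p <= M%:R * Lam `^ p ->
  rnorm (\sum_(b < M) U N b (h b)) <= beta * (M%:R * Lam).

Lemma nres2_le N b x : 1 < N -> rnorm (U N b x) <= C ^+ 2 * rnorm x.
Proof.
move=> N1; have wb := cabs_rootX w1 b.
by rewrite (le_trans (nres_le HR _ N1 wb))// expr2 -mulrA ler_wpM2l// (nres_le HR).
Qed.

Lemma square_mean_le0 N : 1 < N -> square_mean_le N (C ^+ 2).
Proof.
move=> N1 h Lam L0 hL.
have := Lp_L1 (a := fun b => rnorm (h b)) p1 M0 L0 (fun b => rnorm_ge0 _) hL.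
move=> /(ler_wpM2l (exprn_ge0 2 C0)); apply: le_trans.
rewrite (le_trans (rnorm_sum _ _ _))// mulr_sumr ler_sum// => b _.
exact: nres2_le.
Qed.

Lemma U_add N b x y : 1 < N -> U N b (x + y) = U N b x + U N b y.
Proof. by move=> N1; rewrite !(nresD HR)// cabs_rootX. Qed.

(** The sum of the errors [e1], [e3] and [e4] in [one_scale], with [8 + 3 / 2] rounded up to 10. *)
Definition err_const : R := 10 * C ^+ 3 + 40 * C ^+ 5 * tau.

Lemma one_scale (N N' beta delta Lam Lam' : R) (L L' : nat) (h : nat -> X) :
  square_mean_le N' beta ->
  (0 < L)%N -> (0 < L')%N -> (L' %| L)%N -> (L %| M)%N ->
  1 < N' -> 2 * N' <= N ->
  N' / N <= delta -> N' * L'%:R / M%:R <= delta -> M%:R / (L%:R * N') <= delta ->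
  N'^-1 <= delta -> N' / M%:R <= delta ->
  0 <= Lam -> \sum_(b < M) rnorm (h b) `^ p <= M%:R * Lam `^ p ->
  let k b := U N b (h b) in
  0 <= Lam' ->
  \sum_(b < M) rnorm (block_mean L' k b - block_mean L k b) `^ p <= M%:R * Lam' `^ p ->
  rnorm (\sum_(b < M) U N b (h b)) <=
    beta * (M%:R * Lam') + err_const * delta * (M%:R * Lam).
Proof.
move=> Hb L0 L'0 L'L LM N'1 NN d1 d2 d3 d4 d5 Lam0 hL k Lam'0 hd.
have N'0 : 0 < N' := lt_trans ltr01 N'1.
have N1 : 1 < N by lra.
have L'M : (L' %| M)%N := dvdn_trans L'L LM.
have delta0 : 0 <= delta by rewrite (le_trans _ d4)// invr_ge0 ltW.
have h1 := Lp_L1 (a := fun b => rnorm (h b)) p1 M0 Lam0 (fun b => rnorm_ge0 _) hL.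
set W := M%:R * Lam.
have W0 : 0 <= W by rewrite mulr_ge0// ltW.
have k1 : \sum_(b < M) rnorm (k b) <= C ^+ 2 * W.
  apply: le_trans (ler_wpM2l (exprn_ge0 2 C0) h1).
  by rewrite mulr_sumr ler_sum// => b _; exact: nres2_le.
have kL1 := le_trans (block_mean_L1 k L0 LM) k1.
have kL'1 := le_trans (block_mean_L1 k L'0 L'M) k1.
pose d b := block_mean L' k b - block_mean L k b.
pose o b := k b - block_mean L' k b.
(* The pieces are: the error of inserting the scale [N'] ([e1]), the martingale increment ([e2]),
   the mean over long blocks ([e3]), where the squares nearly cancel, and the oscillation inside
   short blocks ([e4]). *)
have split_k : \sum_(b < M) U N b (h b) =
    - (\sum_(b < M) (U N' b (k b) - k b)) + (\sum_(b < M) U N' b (d b) +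
    \sum_(b < M) U N' b (block_mean L k b) + \sum_(b < M) U N' b (o b)).
  rewrite -!big_split/= -sumrN -big_split/=; apply: eq_bigr => b _.
  by rewrite -!U_add// /d /o subrK [block_mean L' k b + _]addrC subrK opprB subrK.
have e1 : rnorm (- (\sum_(b < M) (U N' b (k b) - k b))) <= 8 * C ^+ 3 * delta * W.
  rewrite rnormN (le_trans (rnorm_sum _ _ _))//.
  have c0 : 0 <= 8 * C ^+ 3 * delta by rewrite !mulr_ge0 ?exprn_ge0.
  apply: le_trans (ler_wpM2l c0 h1); rewrite mulr_sumr ler_sum// => b _.
  rewrite (le_trans (nres2_mul HR C1 _ N'1 NN (cabs_rootX w1 b)))//.
  by rewrite ler_wpM2r ?rnorm_ge0// ler_wpM2l// mulr_ge0 ?exprn_ge0.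
have e2 : rnorm (\sum_(b < M) U N' b (d b)) <= beta * (M%:R * Lam') by exact: Hb.
have e3 : rnorm (\sum_(b < M) U N' b (block_mean L k b)) <=
    C * (delta / 2 + delta + 8 * C ^+ 2 * tau * delta) * (C ^+ 2 * W).
  set c := C * _.
  have c0 : 0 <= c by rewrite /c !mulr_ge0 ?addr_ge0 ?mulr_ge0 ?exprn_ge0 ?divr_ge0.
  apply: le_trans (ler_wpM2l c0 kL1).
  rewrite (sum_blocks (fun b => U N' b (block_mean L k b)) L0 LM).
  rewrite (sum_blocks (fun b => rnorm (block_mean L k b)) L0 LM).
  rewrite (le_trans (rnorm_sum _ _ _))// mulr_sumr ler_sum// => a _.
  have E j : (j < L)%N -> block_mean L k (a * L + j)%N = block_mean L k (a * L)%N.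
    by move=> jL; apply: block_mean_eq; rewrite (block_divn a (Ordinal jL)) mulnK.
  under eq_bigr => j _ do rewrite (E j (ltn_ord j)).
  under [X in _ <= _ * X]eq_bigr => j _ do rewrite (E j (ltn_ord j)).
  rewrite (le_trans (nres2_block HR C1 tau0 Ttau w1 wM wM' M0 _ _ _ N'1))//.
  rewrite sumr_const card_ord -[rnorm _ *+ L]mulr_natl [c * _]mulrA ler_wpM2r ?rnorm_ge0//.
  rewrite /c -[leRHS]mulrA ler_wpM2l//.
  have Lr : 0 < L%:R :> R by rewrite ltr0n.
  rewrite [leRHS]mulrC !mulrDr.
  have h2 := ler_wpM2l (ltW Lr) d3; have h3 := ler_wpM2l (ltW Lr) d4.
  have c1 : 0 <= 8 * C ^+ 2 * tau * L%:R by rewrite !mulr_ge0 ?exprn_ge0// ltW.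
  have h4 := ler_wpM2l c1 d5.
  rewrite lerD//; first rewrite lerD//.
    rewrite [leRHS]mulrA.
    have -> : M%:R / (2 * N') = L%:R * (M%:R / (L%:R * N')) / 2.
      by field; rewrite !gt_eqF.
    by rewrite ler_wpM2r.
  by rewrite (le_trans h4)// le_eqVlt; apply/orP; left; apply/eqP; ring.
have e4 : rnorm (\sum_(b < M) U N' b (o b)) <= 16 * C ^+ 3 * tau * delta * (2 * (C ^+ 2 * W)).
  have o1 : \sum_(b < M) rnorm (o b) <= 2 * (C ^+ 2 * W).
    rewrite mulr_natl mulr2n; apply: le_trans (lerD k1 kL'1).
    by rewrite -big_split/= ler_sum// => b _; exact: rnormB.
  have c0 : 0 <= 16 * C ^+ 3 * tau * delta by rewrite !mulr_ge0 ?exprn_ge0.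
  apply: le_trans (ler_wpM2l c0 o1).
  rewrite (sum_blocks (fun b => U N' b (o b)) L'0 L'M).
  rewrite (sum_blocks (fun b => rnorm (o b)) L'0 L'M).
  rewrite (le_trans (rnorm_sum _ _ _))// mulr_sumr ler_sum// => a _.
  rewrite (le_trans (nres2_oscillation HR C1 tau0 Ttau w1 wM M0 N'1 L'0 _))//.
    by rewrite /o sumrB sum_block_mean// subrr.
  rewrite ler_wpM2r ?sumr_ge0//; first by move=> *; exact: rnorm_ge0.
  by rewrite ler_wpM2l ?mulr_ge0 ?exprn_ge0.
rewrite split_k (le_trans (rnormD _ _))// (le_trans (lerD e1 (rnormD _ _)))//.
rewrite (le_trans (lerD (lexx _) (lerD (rnormD _ _) e4)))//.
rewrite (le_trans (lerD (lexx _) (lerD (lerD e2 e3) (lexx _))))//.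
rewrite [leLHS](_ : _ = beta * (M%:R * Lam') +
   (8 * C ^+ 3 + 3 / 2 * C ^+ 3 + 40 * C ^+ 5 * tau) * delta * W); last by field.
rewrite lerD2l ler_wpM2r// ler_wpM2r// /err_const lerD2r.
by have := exprn_ge0 3 C0; lra.
Qed.

(** The [H] applications of [one_scale] bound the same quantity, so their average does too, and the
    increments are small on average. *)
Lemma square_mean_step (beta : R) (H g l m : nat) :
  M = (2 ^ m)%N -> 0 <= beta -> (0 < H)%N -> (0 < g)%N ->
  (forall (L : nat -> nat) (k : nat -> X),
    (forall n, (n <= H)%N -> (0 < L n)%N /\ (L n %| M)%N) ->
    (forall n, (n < H)%N -> (L n.+1 %| L n)%N) ->
    \sum_(i < H) \sum_(b < M)
       rnorm (block_mean (L i.+1) k b - block_mean (L i) k b) `^ p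
    <= (4 * C ^+ 2)^-1 `^ p * H%:R * \sum_(b < M) rnorm (k b) `^ p) ->
  (2 * g * (l + H) + g <= m)%N ->
  (forall n, (1 <= n <= H)%N -> square_mean_le (2 ^+ (2 * g * (l + n))) beta) ->
  forall N, 2 ^+ (2 * g * (l + H).+1) <= N ->
  square_mean_le N (beta / 4 + err_const * 2^-1 ^+ g).
Proof.
move=> Mm beta0 H0 g0 gain gm IH N hN h Lam Lam0 hL.
have Hr : 0 < H%:R :> R by rewrite ltr0n.
pose k b := U N b (h b).
(* The frequency [M / L n] is the geometric mean of the scales with indices [n] and [n.+1]: [L n] is
   long for scale [n.+1], and [L n.+1] is short for it. *)
pose L n := (2 ^ (m - (2 * g * (l + n) + g)))%N.
have gml n : (n <= H)%N -> (2 * g * (l + n) + g <= m)%N.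
  by move=> nH; rewrite (leq_trans _ gm)// leq_add2r leq_mul2l leq_add2l nH orbT.
have LM n : (n <= H)%N -> (0 < L n)%N /\ (L n %| M)%N.
  by move=> nH; rewrite /L expn_gt0 Mm dvdn_exp2l ?leq_subr.
have LL n : (n < H)%N -> (L n.+1 %| L n)%N.
  by move=> nH; rewrite /L dvdn_exp2l// leq_sub2l// leq_add2r leq_mul2l leq_add2l leqnSn orbT.
pose delta : R := 2^-1 ^+ g.
have two0 j : 0 < 2 ^+ j :> R by rewrite exprn_gt0.
have pow_le (a b : nat) : (a <= b)%N -> 2 ^+ a <= 2 ^+ b :> R.
  by move=> ab; rewrite ler_weXn2l// ler1n.
have pow_ratio (a b c : nat) : (a + g <= b)%N -> 2 ^+ a / 2 ^+ b <= delta.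
  move=> ab; rewrite /delta exprVn ler_pdivrMr// ler_pdivlMl// -exprD addnC.
  exact: pow_le.
have N1 : 1 < N.
  rewrite (lt_le_trans _ hN)// exprn_egt1 ?ltr1n// -lt0n muln_gt0/= muln_gt0.
  by rewrite g0.
have k_p : \sum_(b < M) rnorm (k b) `^ p <= (C ^+ 2) `^ p * (M%:R * Lam `^ p).
  apply: le_trans (ler_wpM2l (powR_ge0 _ _) hL); rewrite mulr_sumr ler_sum// => b _.
  rewrite -(powRM p (exprn_ge0 2 C0) (rnorm_ge0 _)).
  by rewrite ge0_ler_powR ?nnegrE ?rnorm_ge0 ?mulr_ge0 ?exprn_ge0 ?rnorm_ge0 ?nres2_le// ltW.
pose S i := \sum_(b < M) rnorm (block_mean (L i.+1) k b - block_mean (L i) k b) `^ p.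
have S0 i : 0 <= S i by rewrite sumr_ge0// => ? _; exact: powR_ge0.
pose La i := (M%:R^-1 * S i) `^ p^-1.
have La0 i : 0 <= La i by exact: powR_ge0.
have Lap i : La i `^ p = M%:R^-1 * S i.
  by rewrite /La -powRrM mulVf ?gt_eqF// powRr1// mulr_ge0 ?invr_ge0 ?S0.
have scale (i : 'I_H) : rnorm (\sum_(b < M) U N b (h b)) <=
    beta * (M%:R * La i) + err_const * delta * (M%:R * Lam).
  have iH := ltn_ord i.
  have [L0 LdM] := LM i (ltnW iH); have [L'0 _] := LM i.+1 iH.
  have MR : M%:R = 2 ^+ m :> R by rewrite Mm natrX.
  have LR n : (L n)%:R = 2 ^+ (m - (2 * g * (l + n) + g)) :> R by rewrite natrX.
  have [x1 x2 x3 x4 [x5 x6]] := scale_exponents g0 iH gm.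
  apply: (one_scale (L := L i) (L' := L i.+1) (N' := 2 ^+ (2 * g * (l + i.+1)))) => //.
  - exact: IH.
  - exact: LL.
  - rewrite exprn_egt1 ?ltr1n// -lt0n muln_gt0/= muln_gt0 g0/=.
    by rewrite addnS.
  - by rewrite (le_trans _ hN)// -exprS pow_le.
  - apply: (@le_trans _ _ (2 ^+ (2 * g * (l + i.+1)) / 2 ^+ (2 * g * (l + H).+1))).
      by rewrite ler_wpM2l ?(ltW (two0 _))// lef_pV2 ?posrE ?(lt_trans ltr01 N1).
    exact: pow_ratio.
  - by rewrite MR LR -exprD; apply: pow_ratio.
  - by rewrite MR LR -exprD; apply: pow_ratio.
  - rewrite -[_^-1]mul1r -[1](expr0 2); exact: pow_ratio.
  - by rewrite MR; apply: pow_ratio.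
  - by rewrite Lap mulrA divff ?mul1r// gt_eqF.
(* The gain [(4 * C ^+ 2)^-1] compensates the norm [C ^+ 2] of the passage from [h] to [k] and
   leaves 1/4; Jensen's inequality passes from p-th powers to the norms [La i]. *)
have sumLa : \sum_(i < H) La i <= H%:R * (Lam / 4).
  apply: (Lp_L1 p1 H0) => //; first by rewrite divr_ge0.
  under eq_bigr do rewrite Lap.
  rewrite -mulr_sumr ler_pdivrMl// (le_trans (gain L k LM LL))//.
  have e0 : 0 <= (4 * C ^+ 2)^-1 `^ p * H%:R by rewrite mulr_ge0 ?powR_ge0// ltW.
  rewrite (le_trans (ler_wpM2l e0 k_p))// le_eqVlt; apply/orP; left; apply/eqP.
  have Cn : 0 < C ^+ 2 by rewrite exprn_gt0// (lt_le_trans ltr01).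
  have -> : Lam / 4 = ((4 * C ^+ 2)^-1 * C ^+ 2) * Lam.
    by field; rewrite gt_eqF// (lt_le_trans ltr01 C1).
  have iC : 0 <= (4 * C ^+ 2)^-1 by rewrite invr_ge0 mulr_ge0// ltW.
  rewrite (powRM p (mulr_ge0 iC (ltW Cn)) Lam0) (powRM p iC (ltW Cn)).
  by set u := (4 * _)^-1 `^ p; set v := (C ^+ 2) `^ p; ring.
set V := rnorm _ in scale *; set E := err_const * delta * _ in scale.
have hs : H%:R * V <= beta * M%:R * (\sum_(i < H) La i) + H%:R * E.
  have -> : H%:R * V = \sum_(i < H) V by rewrite sumr_const card_ord mulr_natl.
  have -> : H%:R * E = \sum_(i < H) E by rewrite sumr_const card_ord mulr_natl.
  rewrite mulr_sumr -big_split/=; apply: ler_sum => i _.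
  by rewrite -mulrA.
have hb := ler_wpM2l (mulr_ge0 beta0 (ltW Mr)) sumLa.
rewrite -(ler_pM2l Hr); apply: (le_trans hs); apply: (le_trans (lerD hb (lexx _))).
rewrite le_eqVlt; apply/orP; left; apply/eqP.
by rewrite /E /delta; field.
Qed.

(* Each group of H + 1 scales halves the bound. *)
Lemma square_mean_decay (H g K m : nat) :
  M = (2 ^ m)%N -> (0 < H)%N -> (0 < g)%N ->
  (forall (L : nat -> nat) (k : nat -> X),
    (forall n, (n <= H)%N -> (0 < L n)%N /\ (L n %| M)%N) ->
    (forall n, (n < H)%N -> (L n.+1 %| L n)%N) ->
    \sum_(i < H) \sum_(b < M)
       rnorm (block_mean (L i.+1) k b - block_mean (L i) k b) `^ p
    <= (4 * C ^+ 2)^-1 `^ p * H%:R * \sum_(b < M) rnorm (k b) `^ p) ->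
  4 * err_const * 2 ^+ K <= 2 ^+ g ->
  (2 * g * (K * H.+1) + g <= m)%N ->
  forall N, 1 < N -> 2 ^+ (2 * g * (K * H.+1)) <= N ->
  square_mean_le N (C ^+ 2 / 2 ^+ K).
Proof.
move=> Mm H0 g0 gain; elim: K => [|K IH] hg gm N N1 hN.
  by rewrite expr0 divr1; exact: square_mean_le0.
have ec0 : 0 <= err_const by rewrite addr_ge0 ?mulr_ge0 ?exprn_ge0.
have hgK : 4 * err_const * 2 ^+ K <= 2 ^+ g.
  rewrite (le_trans _ hg)// ler_wpM2l ?mulr_ge0// exprS.
  by rewrite ler_peMl ?exprn_ge0// ler1n.
have gmK : (2 * g * (K * H.+1) + g <= m)%N.
  by rewrite (leq_trans _ gm)// leq_add2r leq_mul2l leq_mul2r leqnSn !orbT.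
have two0 j : 0 < 2 ^+ j :> R by rewrite exprn_gt0.
have step : square_mean_le N (C ^+ 2 / 2 ^+ K / 4 + err_const * 2^-1 ^+ g).
  apply: (square_mean_step (l := K * H.+1) Mm _ H0 g0 gain) => //.
  - by rewrite divr_ge0 ?exprn_ge0.
  - by rewrite (leq_trans _ gm)// leq_add2r leq_mul2l [(K.+1 * _)%N]mulSnr leq_add2l leqnSn orbT.
  - move=> n /andP[n1 nH]; apply: IH => //.
      by rewrite exprn_egt1 ?ltr1n// -lt0n !muln_gt0 g0 addn_gt0 n1 orbT.
    by rewrite ler_weXn2l ?ler1n// leq_mul2l leq_addr orbT.
  - by rewrite -addnS addnC -mulSn.
move=> h Lam Lam0 hL; rewrite (le_trans (step h Lam Lam0 hL))//.
rewrite ler_wpM2r ?mulr_ge0 ?(ltW Mr)//.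
rewrite [2 ^+ K.+1]exprS exprVn.
(* The margin [g] makes the error at most a quarter of the previous bound; with the quarter from
   [step] this gives one half. *)
have h1 : err_const / 2 ^+ g <= C ^+ 2 / (2 * 2 ^+ K) / 2.
  rewrite ler_pdivrMr//.
  have h2 : 4 * err_const * 2 ^+ K <= 2 ^+ g * C ^+ 2.
    rewrite (le_trans hgK)// ler_peMr ?(ltW (two0 _))//.
    by rewrite expr2 (le_trans C1)// ler_peMl.
  rewrite -(ler_pM2l (_ : 0 < 4 * 2 ^+ K)) ?mulr_gt0//.
  rewrite [leRHS](_ : _ = 2 ^+ g * C ^+ 2); last by field; rewrite gt_eqF.
  by rewrite mulrAC.
rewrite (le_trans (lerD (lexx _) h1))// le_eqVlt; apply/orP; left; apply/eqP.
by field; rewrite gt_eqF.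
Qed.

End scales.

Arguments err_const {R} C tau.
Arguments square_mean_le {R X} res w M p N beta.

(** * Growth of the powers *)

Section roots_of_unity_sum.
Context {R : realType}.

(** The order of [w] divides [2 ^ m.+1], and the value -1 excludes the smaller powers of 2; the rest
    is orthogonality of characters. *)
Lemma sum_root_powers (m : nat) (w : R[i]) (j : nat) : w ^+ (2 ^ m) = -1 ->
  \sum_(b < 2 ^ m.+1) w ^+ (b * j) =
    if (2 ^ m.+1 %| j)%N then (2 ^ m.+1)%:R else 0.
Proof.
move=> wm; have wM : w ^+ (2 ^ m.+1) = 1 by rewrite expnS mulnC exprM wm expr2 mulrNN mulr1.
have prim : (2 ^ m.+1).-primitive_root w.
  have [k pk kM] := prim_order_exists (expn_gt0 2 m.+1 : (0 < 2 ^ m.+1)%N) wM.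
  have /(dvdn_pfactor _ _ (isT : prime 2))[i im ki] := kM.
  move: im; rewrite leq_eqVlt => /predU1P[im|im]; first by rewrite -im -ki.
  have : w ^+ (2 ^ m) == 1.
    by rewrite -(prim_order_dvd pk) ki dvdn_exp2l.
  by rewrite wm eq_sym -subr_eq0 opprK -mulr2n pnatr_eq0.
under eq_bigr do rewrite mulnC exprM.
case: ifP => h.
  have /eqP -> : w ^+ j == 1 by rewrite -(prim_order_dvd prim).
  by under eq_bigr do rewrite expr1n; rewrite sumr_const card_ord.
have nz : w ^+ j - 1 != 0 by rewrite subr_eq0 -(prim_order_dvd prim) h.
apply: (mulfI nz); rewrite mulr0 -subrX1 -exprM mulnC exprM wM expr1n.
exact: subrr.
Qed.

Lemma sum_sqr_root_powers (m : nat) (z : R[i]) (k : nat) : z ^+ (2 ^ m) = -1 ->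
  (0 < k < 2 ^ m)%N -> \sum_(b < 2 ^ m) (z ^+ 2) ^+ (b * k) = 0.
Proof.
case: m => [|m] zm /andP[k0 kM]; first by case: k k0 kM.
rewrite sum_root_powers; last by rewrite -exprM -expnS.
by rewrite gtnNdvd.
Qed.

End roots_of_unity_sum.

Section powers.
Context {R : realType} {X : normedModType R[i]} (T : {linear X -> X}).

Definition powT (n : nat) : X -> X := iter n T.

Lemma powT_linear n : linear (powT n).
Proof.
elim: n => [|n IH] a x y //.
by rewrite /powT /= -![iter n _ _]/(powT n _) IH linearP.
Qed.

HB.instance Definition _ n :=
  GRing.isLinear.Build R[i] X X *:%R (powT n) (powT_linear n).

Lemma powTD m n x : powT (m + n) x = powT m (powT n x).
Proof. by rewrite /powT iterD. Qed.

Lemma powTC m n x : powT m (powT n x) = powT n (powT m x).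
Proof. by rewrite -!powTD addnC. Qed.

Lemma powT_continuous n : continuous T -> continuous (powT n).
Proof.
move=> cT; elim: n => [|n IH] x; first exact: cvg_id.
by apply: (@continuous_comp _ _ _ (powT n) T); [exact: IH|exact: cT].
Qed.

Definition geomT (z : R[i]) M x : X := \sum_(k < M) z ^+ k *: powT k x.

Lemma geomT_comm z M c n x :
  geomT z M (x - c *: powT n x) = geomT z M x - c *: powT n (geomT z M x).
Proof.
rewrite /geomT linear_sum scaler_sumr -sumrB; apply: eq_bigr => k _.
rewrite linearB/= scalerBr; congr (_ - _).
by rewrite !linearZ/= powTC !scalerA mulrC.
Qed.

Lemma geomT_telescope z M x :
  geomT z M (x - z *: T x) = x - z ^+ M *: powT M x.
Proof.
rewrite /geomT; elim: M => [|M IH].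
  by rewrite big_ord0 expr0 scale1r /powT /= subrr.
rewrite big_ord_recr/= IH linearB/= [powT M (z *: _)]linearZ/= scalerBr scalerA -exprSr addrA subrK.
by rewrite /powT -iterSr.
Qed.

End powers.

(** * Smallness of high powers, and Fourier coefficients *)

Section power_bounds.
Context {R : realType} {X : normedModType R[i]} {T : {linear X -> X}} {C tau : R}
  {res : R[i] -> X -> X}.
Hypothesis HR : is_resolvent T C res.
Hypothesis C1 : 1 <= C.
Hypothesis tau0 : 0 <= tau.
Hypothesis Ttau : forall x, rnorm (T x) <= tau * rnorm x.
Hypothesis cT : continuous T.

Let C0 : 0 <= C := le_trans ler01 C1.
Local Notation P := (powT T).

Lemma geomT_res z M x : 0 < cabs z < 1 ->
  geomT T z M x = res z x - z ^+ M *: P M (res z x).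
Proof.
move=> hz; rewrite -geomT_telescope; congr geomT.
by rewrite (resKV HR)// subKr.
Qed.

(* Averaging resolvents over the M-th roots of 1 and of -1 gives
   (1 - W)^-1 and (1 + W)^-1, W = (rho T)^M; these averages are close to each
   other, so W is small as soon as it is a contraction. *)
Lemma half_norm_quarter (rho N : R) m (W := fun x => (rho ^+ (2 ^ m))%:C *: P (2 ^ m) x) :
  1 < N -> 0 < rho -> rho <= 1 - N^-1 -> 18 * C ^+ 2 * N ^+ 2 * tau <= (2 ^ m)%:R ->
  (forall x, rnorm (W x) <= 2^-1 * rnorm x) ->
  forall x, rnorm (W x) <= 4^-1 * rnorm x.
Proof.
move=> N1 rho0 rhoN hM Wh x; set M := (2 ^ m)%N in W hM Wh *.
have N0 : 0 < N := lt_trans ltr01 N1.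
have Mr : 0 < M%:R :> R by rewrite ltr0n expn_gt0.
have rho1 : rho < 1 by rewrite (le_lt_trans rhoN)// ltrBlDr ltrDl invr_gt0.
have [z [z1 zM zn]] := @root_of_unity R m.
pose w := z ^+ 2.
have w1 b : cabs (w ^+ b) = 1 by rewrite !cabsX z1 !expr1n.
have zw1 b : cabs (z * w ^+ b) = 1 by rewrite cabsM z1 w1 mulr1.
have dom l : cabs l = 1 -> 0 < cabs (rho%:C * l) < 1.
  by move=> l1; rewrite cabsM cabs_real ?(ltW rho0)// l1 mulr1 rho0.
have resb l y : cabs l = 1 -> rnorm (res (rho%:C * l) y) <= C * N * rnorm y.
  move=> l1; rewrite (le_trans (res_le HR _ (dom l l1)))//.
  rewrite ler_wpM2r ?rnorm_ge0// ler_wpM2l// cabsM cabs_real ?(ltW rho0)// l1 mulr1.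
  rewrite -[leRHS]invrK lef_pV2 ?posrE ?invr_gt0 ?subr_gt0//.
  by rewrite lerBrDr -lerBrDl.
pose Q1 := \sum_(b < M) res (rho%:C * w ^+ b) x.
pose Q2 := \sum_(b < M) res (rho%:C * (z * w ^+ b)) x.
have zM' : z ^+ M = -1 := zM.
have wM0 : w ^+ M = 1 by rewrite /w -exprM mulnC exprM zM' expr2 mulrNN mulr1.
have wM b : (w ^+ b) ^+ M = 1 by rewrite -exprM mulnC exprM wM0 expr1n.
have rM l : (rho%:C * l) ^+ M = (rho ^+ M)%:C * l ^+ M by rewrite exprMn rmorphXn.
(* Averaging over the [M]-th roots of unity kills every power of [T] from 1 to [M - 1]. *)
have sum1 (c : R[i]) : \sum_(b < M) geomT T (c * w ^+ b) M x = M%:R *: x.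
  have Mgt0 : (0 < M)%N by rewrite expn_gt0.
  rewrite /geomT exchange_big/=.
  transitivity (\sum_(k < M) (if (k == 0 :> nat) then M%:R *: x else 0)).
    apply: eq_bigr => k _.
    rewrite -scaler_suml.
    have -> : \sum_(b < M) (c * w ^+ b) ^+ k = c ^+ k * \sum_(b < M) w ^+ (b * k).
      by rewrite mulr_sumr; apply: eq_bigr => b _; rewrite exprMn exprM.
    have [k0|k0] := eqVneq (k : nat) 0%N.
      rewrite k0 expr0 mul1r; under eq_bigr do rewrite muln0 expr0.
      by rewrite sumr_const card_ord.
    by rewrite sum_sqr_root_powers ?mulr0 ?scale0r// lt0n k0/=.
  rewrite (bigD1 (Ordinal Mgt0))//= big1 ?addr0// => k kn.
  by rewrite ifN//; apply: contraNneq kn => k0; apply/eqP/val_inj.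
have E1 : Q1 - W Q1 = M%:R *: x.
  rewrite -(sum1 rho%:C) /W linear_sum scaler_sumr -sumrB; apply: eq_bigr => b _.
  by rewrite geomT_res ?dom// rM wM mulr1.
have E2 : Q2 + W Q2 = M%:R *: x.
  rewrite -(sum1 (rho%:C * z)) /W linear_sum scaler_sumr -big_split/=; apply: eq_bigr => b _.
  rewrite -mulrA geomT_res ?dom// rM [(z * _) ^+ M]exprMn wM mulr1 zM' mulrN1.
  by rewrite scaleNr opprK.
have WD u v : W (u + v) = W u + W v by rewrite /W linearD scalerDr.
have WN u : W (- u) = - W u by rewrite /W linearN scalerN.
(* This is [(1 - W)^-1 - (1 + W)^-1 = 2 W (1 - W^2)^-1], with the inverse cleared. *)
have E3 : (2 * M%:R) *: W x = (Q1 - Q2) - W (W (Q1 - Q2)).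
  have WZ c : W (c *: x) = c *: W x by rewrite /W linearZ/= !scalerA mulrC.
  have F1 : Q1 = M%:R *: x + W Q1 by rewrite -E1 subrK.
  have F2 : Q2 = M%:R *: x - W Q2 by rewrite -E2 addrK.
  have G1 : Q1 - W (W Q1) = M%:R *: x + W (M%:R *: x).
    by rewrite -{1}E1 -E1 WD WN addrA subrK.
  have G2 : Q2 - W (W Q2) = M%:R *: x - W (M%:R *: x).
    by rewrite -{1}E2 -E2 WD opprD addrA addrK.
  have -> : Q1 - Q2 - W (W (Q1 - Q2)) = (Q1 - W (W Q1)) - (Q2 - W (W Q2)).
    by rewrite !(WD, WN) !opprD !opprK addrACA.
  rewrite G1 G2 WZ opprD opprK addrACA subrr add0r -scalerDl; congr (_ *: _).
  by rewrite mulr_natl mulr2n.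
(* Each root of 1 is paired with a root of -1 at distance at most [4 / M]. *)
have dQ : rnorm (Q1 - Q2) <= 4 * C ^+ 2 * N ^+ 2 * tau * rnorm x.
  rewrite /Q1 /Q2 -sumrB (le_trans (rnorm_sum _ _ _))//.
  apply: (@le_trans _ _ (\sum_(b < M) (4 / M%:R) * (C * N * (tau * (C * N * rnorm x))))).
    apply: ler_sum => b _; rewrite (res_identity HR) ?dom// rnorm_scale.
    apply: ler_pM; rewrite ?cabs_ge0 ?rnorm_ge0//.
      rewrite -mulrBr -{1}[w ^+ b]mul1r -mulrBl !cabsM w1 mulr1 cabs_real ?(ltW rho0)//.
      rewrite cabs_distC (le_trans _ zn)// ler_piMl ?cabs_ge0// ltW//.
    rewrite (le_trans (resb _ _ (w1 _)))// ler_wpM2l ?mulr_ge0 ?(ltW N0)//.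
    by rewrite (le_trans (Ttau _))// ler_wpM2l// resb.
  rewrite sumr_const card_ord -[leLHS]mulr_natl le_eqVlt; apply/orP; left; apply/eqP.
  by field; rewrite gt_eqF.
have hW (y : X) : rnorm (y - W (W y)) <= 5 / 4 * rnorm y.
  rewrite (le_trans (rnormB _ _))//.
  have := Wh (W y); have := Wh y; have := rnorm_ge0 y; lra.
have := le_trans (hW (Q1 - Q2)) (ler_wpM2l (_ : 0 <= 5 / 4) dQ).
rewrite divr_ge0// => /(_ isT); rewrite -E3 rnorm_scale.
have -> : cabs (2 * M%:R : R[i]) = 2 * M%:R.
  rewrite -natrM -[(2 * M)%:R](rmorph_nat (real_complex R)).
  rewrite cabs_real; last exact: ler0n.
  exact: natrM.
move=> h; have xr := rnorm_ge0 x.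
have h2 := ler_wpM2r xr hM.
have M2 : 0 < 2 * M%:R :> R by rewrite mulr_gt0.
rewrite -(ler_pM2l M2).
apply: (le_trans h); move: h2.
set q := C ^+ 2 * N ^+ 2 * tau * rnorm x.
have q0 : 0 <= q by rewrite /q !mulr_ge0 ?exprn_ge0// ltW.
rewrite (_ : 18 * C ^+ 2 * N ^+ 2 * tau * rnorm x = 18 * q); last by rewrite /q; ring.
rewrite (_ : 5 / 4 * _ = 5 * q); last by rewrite /q; field.
by lra.
Qed.

(** If the norm of [(r T)^M] exceeded 1/2, a smaller radius [rho] would make the norm of [(rho T)^M]
    exactly 1/2, and [half_norm_quarter] would lower it to 1/4. *)
Lemma pow_half (N : R) m : 1 < N -> 18 * C ^+ 2 * N ^+ 2 * tau <= (2 ^ m)%:R ->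
  forall x, (1 - N^-1) ^+ (2 ^ m) * rnorm (P (2 ^ m) x) <= 2^-1 * rnorm x.
Proof.
move=> N1 hM; set M := (2 ^ m)%N; set r := 1 - N^-1.
have r0 : 0 < r by rewrite /r subr_gt0 invf_lt1 ?(lt_trans ltr01).
have M0 : (0 < M)%N by rewrite expn_gt0.
have Mr : 0 < M%:R :> R by rewrite ltr0n.
have cP : continuous (P M) := @powT_continuous _ _ T M cT.
set a := opnorm (P M : {linear X -> X}).
have ha x : rnorm (P M x) <= a * rnorm x by exact: rnorm_opnorm.
have [h|h] := leP (r ^+ M * a) 2^-1.
  move=> x; apply: le_trans (ler_wpM2r (rnorm_ge0 x) h).
  by rewrite -mulrA ler_wpM2l ?exprn_ge0 ?(ltW r0).
exfalso.
have a0 : 0 < a.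
  rewrite ltNge; apply/negP => a0; move: h; rewrite ltNge => /negP[].
  rewrite (@le_trans _ _ 0)// ?invr_ge0//.
  by rewrite mulr_ge0_le0// exprn_ge0// ltW.
pose v := (2 * a)^-1.
have v0 : 0 < v by rewrite invr_gt0 mulr_gt0.
pose rho := v `^ M%:R^-1.
have rho0 : 0 < rho by rewrite powR_gt0.
have rhoM : rho ^+ M = v.
  by rewrite -powR_mulrn ?(ltW rho0)// -powRrM mulVf ?gt_eqF// powRr1// ltW.
have rhor : rho <= r.
  rewrite -(@ler_pXn2r _ M) ?nnegrE ?(ltW rho0) ?(ltW r0)// rhoM.
  rewrite /v invfM -ler_pdivlMr ?invr_gt0// invrK; exact: ltW.
have va : v * a = 2^-1 by rewrite /v; field; rewrite gt_eqF.
have W_le x : rnorm ((rho ^+ M)%:C *: P M x) <= 2^-1 * rnorm x.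
  rewrite rhoM rnorm_realZ ?(ltW v0)// -va -mulrA ler_wpM2l ?(ltW v0)//.
have := half_norm_quarter N1 rho0 rhor hM W_le => h4.
have : a <= (4 * v)^-1.
  apply: opnorm_le => x x1; have := h4 x; rewrite -/M rhoM rnorm_realZ ?(ltW v0)// => h5.
  have e4 : v * (4 * v)^-1 = 4^-1 by field; rewrite gt_eqF.
  by rewrite -(ler_pM2l v0) e4 (le_trans h5)// ler_piMr// invr_ge0.
have : (4 * v)^-1 = a / 2 by rewrite /v; field; rewrite gt_eqF.
by move=> ->; lra.
Qed.

Lemma pow_small (N : R) m1 : 1 < N -> exists2 m, (m1 <= m)%N &
  forall x, (2 ^ m)%:R * ((1 - N^-1) ^+ (2 ^ m) * rnorm (P (2 ^ m) x)) <= 2^-1 * rnorm x.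
Proof.
move=> N1; set r := 1 - N^-1.
have r0 : 0 < r by rewrite /r subr_gt0 invf_lt1 ?(lt_trans ltr01).
set B := 18 * C ^+ 2 * N ^+ 2 * tau.
have B0 : 0 <= B by rewrite !mulr_ge0 ?exprn_ge0// ltW// (lt_trans ltr01).
pose m0 := maxn (Num.bound B) m1.
have hB : B <= (2 ^ m0)%:R.
  rewrite (le_trans (ltW (archi_boundP B0)))// ler_nat.
  by rewrite (leq_trans (leq_maxl _ m1))// ltnW// ltn_expl.
have half := pow_half N1 hB; rewrite -/r in half.
pose M0 := (2 ^ m0)%N.
have iterh i x : r ^+ (M0 * i) * rnorm (P (M0 * i) x) <= 2^-1 ^+ i * rnorm x.
  elim: i x => [|i IH] x; first by rewrite muln0 !expr0 /powT.
  rewrite mulnS powTD exprD -mulrA mulrCA.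
  have := half (P (M0 * i) x) => /(ler_wpM2l (exprn_ge0 (M0 * i) (ltW r0))) /le_trans; apply.
  by rewrite mulrCA exprS -mulrA ler_wpM2l ?invr_ge0.
(* Iterating [2 ^ j] times gives [2^-1 ^+ (2 ^ j)], which beats the factor [2 ^ (m0 + j)] as soon as
   [m0 + j < 2 ^ j]. *)
pose j := m0.+2.
exists (m0 + j)%N; first by rewrite (leq_trans (leq_maxr (Num.bound B) m1))// leq_addr.
move=> x; rewrite expnD -/M0.
rewrite (le_trans (ler_wpM2l _ (iterh _ _)))// ?ler0n// mulrA ler_wpM2r ?rnorm_ge0//.
rewrite /M0 -expnD natrX exprVn -[2^-1]mul1r ler_pdivrMr ?exprn_gt0//.
rewrite mulrC mulrA mulr1 ler_pdivlMr// -exprSr ler_weXn2l ?ler1n//.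
rewrite /j !expnS addnS addnS.
have := ltn_expl m0 (ltnSn 1).
by move: (2 ^ m0)%N => e; clear; lia.
Qed.

(* The n-th Fourier coefficient of (1 - z T)^-2, computed on the M-th roots of
   unity: aliasing only adds terms containing W = (r T)^M. *)
Lemma fourier_coefficient (w : R[i]) (r : R) m n x (M := (2 ^ m.+1)%N)
    (W := fun y => (r ^+ M)%:C *: P M y) :
  w ^+ (2 ^ m) = -1 -> cabs w = 1 -> (n < M)%N -> 0 < r < 1 ->
  let E := \sum_(b < M) w ^+ (b * (M - n)) *:
             res (r%:C * w ^+ b) (res (r%:C * w ^+ b) x) in
  (E - W E) - W (E - W E) =
  M%:R *: (n.+1%:R *: ((r ^+ n)%:C *: P n x) +
           (M - n.+1)%:R *: W ((r ^+ n)%:C *: P n x)).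
Proof.
move=> wm w1 nM /andP[r0 r1] E.
have wM : w ^+ M = 1 by rewrite /M expnS mulnC exprM wm expr2 mulrNN mulr1.
have WD u v : W (u + v) = W u + W v by rewrite /W linearD scalerDr.
have WN u : W (- u) = - W u by rewrite /W linearN scalerN.
have WZ c u : W (c *: u) = c *: W u by rewrite /W linearZ/= !scalerA mulrC.
have Wsum (I : Type) (s : seq I) (F : I -> X) : W (\sum_(i <- s) F i) = \sum_(i <- s) W (F i).
  by rewrite /W linear_sum scaler_sumr.
(* Since [(z b T)^M] equals [W] at every node, [1 - W] turns each resolvent into a geometric sum of
   length [M]; two resolvents call for two such factors. *)
pose V y := y - W y.
have Vsum (F : 'I_M -> X) : V (\sum_(b < M) F b) = \sum_(b < M) V (F b).
  by rewrite /V Wsum -sumrB.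
have VZ c u : V (c *: u) = c *: V u by rewrite /V WZ scalerBr.
pose z b := r%:C * w ^+ b.
have zdom b : 0 < cabs (z b) < 1.
  by rewrite cabsM cabs_real ?(ltW r0)// cabsX w1 expr1n mulr1 r0.
have zM b : z b ^+ M = (r ^+ M)%:C.
  by rewrite exprMn -exprM mulnC exprM wM expr1n mulr1 rmorphXn.
have Vres b y : V (res (z b) y) = geomT T (z b) M y.
  by rewrite geomT_res// zM.
have Vgeom b y : V (geomT T (z b) M y) = geomT T (z b) M (V y).
  by rewrite /V /W geomT_comm.
rewrite -[LHS]/(V (V E)).
have -> : V (V E) = \sum_(b < M) w ^+ (b * (M - n)) *: geomT T (z b) M (geomT T (z b) M x).
  rewrite /E !Vsum; apply: eq_bigr => b _; rewrite !VZ -/(z b); congr (_ *: _).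
  by rewrite Vres Vgeom Vres.
have expand b : w ^+ (b * (M - n)) *: geomT T (z b) M (geomT T (z b) M x) =
   \sum_(k < M) \sum_(l < M) (r ^+ (k + l))%:C *: (w ^+ (b * (M - n + (k + l))) *: P (k + l) x).
  rewrite {1}/geomT scaler_sumr; apply: eq_bigr => k _.
  rewrite /geomT linear_sum !scaler_sumr; apply: eq_bigr => l _.
  rewrite /= [powT T k _]linearZ/= -powTD !scalerA; congr (_ *: _).
  rewrite -[_ * z b ^+ k * _]mulrA -exprD exprMn -exprM rmorphXn/=.
  rewrite [(b * (M - n + _))%N]mulnDr [w ^+ (_ + _)]exprD.
  by rewrite mulrCA.
under eq_bigr do rewrite expand.
rewrite exchange_big/=.
under eq_bigr do rewrite exchange_big/=.
have coef j : \sum_(b < M) (r ^+ j)%:C *: (w ^+ (b * (M - n + j)) *: P j x) =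
   if (M %| M - n + j)%N then M%:R *: ((r ^+ j)%:C *: P j x) else 0.
  rewrite -scaler_sumr -scaler_suml sum_root_powers// -/M.
  by case: ifP => _; rewrite ?scale0r ?scaler0// !scalerA mulrC.
under eq_bigr do under eq_bigr do rewrite coef.
have nMe : (n + M - n = M)%N by rewrite addKn.
(* For each [k] a single [l < M] survives: [n - k] for the [n.+1] indices up to [n], and
   [n + M - k], one period later, for the others, which brings in [W]. *)
have inner (k : 'I_M) :
   \sum_(l < M) (if (M %| M - n + (k + l))%N then M%:R *: ((r ^+ (k + l))%:C *: P (k + l) x) else 0)
   = M%:R *: (if (k < n.+1)%N then (r ^+ n)%:C *: P n x else W ((r ^+ n)%:C *: P n x)).
  have kM := ltn_ord k.
  have Wn : W ((r ^+ n)%:C *: P n x) = (r ^+ (M + n))%:C *: P (M + n) x.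
    by rewrite WZ /W scalerA -rmorphM/= -exprD addnC powTD powTC -powTD addnC.
  have [kn|kn] := ltnP k n.+1.
    have lM : (n - k < M)%N by rewrite (leq_ltn_trans (leq_subr _ _)).
    rewrite (bigD1 (Ordinal lM))//= subnKC// subnK ?(ltnW nM)// dvdnn big1 ?addr0// => l ln.
    rewrite ifN//; apply: contraNN ln => /dvdnP[c hc].
    apply/eqP/val_inj => /=; have := ltn_ord l.
    case: c hc => [|[|c]]; rewrite ?mul0n ?mul1n => hc lM'.
    - exfalso; move: hc nM; clear; lia.
    - move: hc nM kn lM'; clear; lia.
    - exfalso; move: hc; rewrite mulSn mulSn.
      move: (c * M)%N => cM; move: nM kn lM' kM; clear; lia.
  have lM : (n + M - k < M)%N by move: nM kn kM; clear; lia.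
  have e1 : (k + (n + M - k) = M + n)%N by move: nM kn kM; clear; lia.
  have e2 : (M - n + (M + n) = M * 2)%N by move: nM; clear; lia.
  rewrite (bigD1 (Ordinal lM))//= e1 e2 dvdn_mulr// Wn big1 ?addr0// => l ln.
  rewrite ifN//; apply: contraNN ln => /dvdnP[c hc].
  apply/eqP/val_inj => /=; have := ltn_ord l.
  case: c hc => [|[|[|c]]]; rewrite ?mul0n ?mul1n => hc lM'.
  - exfalso; move: hc nM; clear; lia.
  - exfalso; move: hc nM kn lM'; clear; lia.
  - move: hc nM kn lM' kM; clear; lia.
  - exfalso; move: hc; rewrite !mulSn.
    move: (c * M)%N => cM; move: nM kn lM' kM; clear; lia.
under eq_bigr do rewrite inner.
rewrite -scaler_sumr; congr (_ *: _).
set u := _ *: P n x; set v := W u.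
have -> : M = (n.+1 + (M - n.+1))%N by rewrite subnKC.
rewrite big_split_ord/=.
under eq_bigr do rewrite ltn_ord.
rewrite sumr_const card_ord -scaler_nat; congr (_ + _).
under eq_bigr do rewrite ltnNge leq_addr/=.
by rewrite sumr_const card_ord -scaler_nat addKn.
Qed.

End power_bounds.

(** * From square means to the growth of the powers *)

Section growth.
Context {R : realType} {X : normedModType R[i]} {T : {linear X -> X}} {C tau : R}
  {res : R[i] -> X -> X}.
Hypothesis HR : is_resolvent T C res.
Hypothesis C1 : 1 <= C.
Hypothesis tau0 : 0 <= tau.
Hypothesis Ttau : forall x, rnorm (T x) <= tau * rnorm x.
Hypothesis cT : continuous T.

Let C0 : 0 <= C := le_trans ler01 C1.
Local Notation P := (powT T).

(** The test function is [x] times a character, so it has constant norm and extracts the n-th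
    Fourier coefficient. The 18 is 9/4 for the two factors [1 - W], times 4 from [N ^+ 2], times 2
    from the lower bound for [r ^+ n]. *)
Lemma powT_le_square_mean (w : R[i]) (p beta : R) m n x (M := (2 ^ m.+1)%N)
    (N := 2 * n%:R) (r := 1 - N^-1) :
  1 < p -> 0 <= beta -> (0 < n)%N -> (n < M)%N -> cabs w = 1 -> w ^+ (2 ^ m) = -1 ->
  (forall y, M%:R * (r ^+ M * rnorm (P M y)) <= 2^-1 * rnorm y) ->
  square_mean_le res w M p N beta ->
  rnorm (P n x) <= 18 * beta * n%:R * rnorm x.
Proof.
move=> p1 beta0 n0 nM w1 wm hW sq.
have nr : 1 <= n%:R :> R by rewrite ler1n.
have N1 : 1 < N by rewrite /N; lra.
have N0 : 0 < N := lt_trans ltr01 N1.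
have Mr : 0 < M%:R :> R by rewrite ltr0n expn_gt0.
have r01 : 0 < r < 1.
  by rewrite subr_gt0 invf_lt1// N1/= ltrBlDr ltrDl invr_gt0.
have /andP[r0 r1] := r01.
pose W v := (r ^+ M)%:C *: P M v.
pose y := (r ^+ n)%:C *: P n x.
pose E := \sum_(b < M) w ^+ (b * (M - n)) *:
             res (r%:C * w ^+ b) (res (r%:C * w ^+ b) x).
have key : E - W E - W (E - W E) = M%:R *: (n.+1%:R *: y + (M - n.+1)%:R *: W y).
  exact: (fourier_coefficient HR x wm w1 nM r01).
have Wy v : M%:R * rnorm (W v) <= 2^-1 * rnorm v.
  by rewrite /W rnorm_realZ ?exprn_ge0 ?(ltW r0)//; exact: hW.
have Mge1 : 1 <= M%:R :> R by rewrite ler1n expn_gt0.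
have W_half v : rnorm (W v) <= 2^-1 * rnorm v.
  by rewrite (le_trans _ (Wy v))// ler_peMl ?rnorm_ge0.
have hE : rnorm E <= N ^+ 2 * (beta * (M%:R * rnorm x)).
  have hx : \sum_(b < M) rnorm (w ^+ (b * (M - n)) *: x) `^ p <= M%:R * rnorm x `^ p.
    under eq_bigr do rewrite rnorm_scale (cabs_rootX w1) mul1r.
    by rewrite sumr_const card_ord mulr_natl.
  have := sq (fun b => w ^+ (b * (M - n)) *: x) _ (rnorm_ge0 x) hx.
  move=> /(ler_wpM2l (exprn_ge0 2 (ltW N0))); apply: le_trans.
  rewrite -rnorm_realZ ?exprn_ge0 ?(ltW N0)// le_eqVlt; apply/orP; left; apply/eqP.
  congr rnorm; rewrite /E scaler_sumr; apply: eq_bigr => b _.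
  have wb := cabs_rootX w1 b.
  have dm : 0 < cabs ((1 - N^-1)%:C * w ^+ b) < 1.
    by have [-> ->] := nres_dom N1 wb.
  rewrite /nres !(resZ HR _ _ dm) !scalerA; congr (_ *: _).
  have NN : (N ^+ 2)%:C * ((N^-1)%:C * (N^-1)%:C) = 1.
    by rewrite -!rmorphM/= expr2 mulrACA divff ?gt_eqF// mulr1.
  by rewrite -[LHS]mul1r -NN; ring.
have hV v : rnorm (v - W v) <= 3 / 2 * rnorm v.
  rewrite (le_trans (rnormB _ _))//.
  by have := W_half v; have := rnorm_ge0 v; lra.
have hVV : rnorm (E - W E - W (E - W E)) <= 9 / 4 * rnorm E.
  by have := hV E; have := hV (E - W E); lra.
(* The aliasing term costs at most half of [rnorm y]; the excess of [n.+1] over [n] absorbs it. *)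
have lower : M%:R * (n%:R * rnorm y) <= 9 / 4 * rnorm E.
  apply: le_trans hVV; rewrite key.
  have -> : M%:R = (M%:R : R)%:C by rewrite rmorph_nat.
  rewrite rnorm_realZ ?ler0n// ler_pM2l//.
  set c := (M - n.+1)%N.
  have -> : n.+1%:R = (n.+1%:R : R)%:C by rewrite rmorph_nat.
  have -> : c%:R = (c%:R : R)%:C by rewrite rmorph_nat.
  set a := _ *: y; set b := _ *: W y.
  have ha : rnorm a = n.+1%:R * rnorm y by rewrite /a rnorm_realZ.
  have hb : rnorm b <= 2^-1 * rnorm y.
    rewrite /b rnorm_realZ// (le_trans _ (Wy y))// ler_wpM2r ?rnorm_ge0//.
    by rewrite ler_nat leq_subr.
  have : rnorm a <= rnorm (a + b) + rnorm b.
    by rewrite -{1}(addrK b a) rnormB.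
  rewrite ha -natr1 mulrDl mul1r.
  by have := rnorm_ge0 y; lra.
have y_le : rnorm y <= 9 * beta * n%:R * rnorm x.
  have n0r : 0 < n%:R :> R by rewrite ltr0n.
  have Mn : 0 < M%:R * n%:R :> R by rewrite mulr_gt0.
  rewrite -(ler_pM2l Mn) -[leLHS]mulrA (le_trans lower)//.
  rewrite (le_trans (ler_wpM2l (_ : 0 <= 9 / 4) hE))//.
  by rewrite le_eqVlt; apply/orP; left; apply/eqP; rewrite /N; field.
(* Bernoulli's inequality for [r = 1 - 1 / (2 n)]; this is why [N] is twice [n]. *)
have rn : 2^-1 <= r ^+ n.
  have bern k : 1 - k%:R * N^-1 <= r ^+ k.
    elim: k => [|k IH]; first by rewrite mul0r subr0 expr0.
    have := ler_wpM2l (ltW r0) IH; rewrite exprS; apply: le_trans.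
    rewrite /r -natr1.
    have k0 : 0 <= k%:R * (N^-1 * N^-1) by rewrite mulr_ge0// mulr_ge0// invr_ge0 ltW.
    rewrite mulrDl mul1r mulrBl mul1r mulrBr mulr1.
    by rewrite [N^-1 * (k%:R * _)]mulrCA; lra.
  rewrite (le_trans _ (bern n))// /N.
  by rewrite le_eqVlt; apply/orP; left; apply/eqP; field; rewrite gt_eqF// (lt_le_trans ltr01).
have := rnorm_ge0 (P n x) => Px0.
have : rnorm y = r ^+ n * rnorm (P n x) by rewrite /y rnorm_realZ// exprn_ge0// ltW.
have := ler_wpM2r Px0 rn; move: y_le; set q := beta * n%:R * rnorm x.
rewrite (_ : 9 * beta * _ * _ = 9 * q); last by rewrite /q; ring.
rewrite (_ : 18 * beta * _ * _ = 18 * q); last by rewrite /q; ring.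
by lra.
Qed.

(** A quartic lower bound for [2 ^ K] leaves two powers of [K] to absorb the constants. *)
Lemma poly_le_exp (a c : nat) : exists K0, forall K, (K0 <= K)%N ->
  (a * ((K + c) * K) <= 2 ^ K)%N.
Proof.
pose B := (a * c.+1)%N.
have four k : (k.+1 ^ 4 <= 256 * 2 ^ k)%N.
  pose j := (k %/ 4)%N.
  have kj : (k.+1 <= 4 * j.+1)%N.
    by rewrite mulnC -ltn_divLR// ltnS.
  apply: (@leq_trans ((4 * j.+1) ^ 4)); first by rewrite leq_exp2r.
  rewrite expnMn leq_mul2l/=.
  apply: (@leq_trans ((2 ^ j) ^ 4)); first by rewrite leq_exp2r// ltn_expl.
  by rewrite -expnM leq_exp2l// leq_divM.
exists (256 * B)%N => K hK.
have h1 : (a * ((K + c) * K) <= B * K.+1 ^ 2)%N.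
  rewrite /B -mulnA leq_mul2l; apply/orP; right.
  rewrite -mulnn mulnA leq_mul//.
  by rewrite mulSn mulnS; lia.
rewrite (leq_trans h1)// -(@leq_pmul2l 256)//.
rewrite (leq_trans _ (four K))// mulnA (_ : 4 = 2 + 2)%N// expnD leq_mul2r.
by rewrite -mulnn (leq_trans hK) ?orbT// (leq_trans (leqnSn K))// leq_pmulr.
Qed.

Lemma ln_le_trunc_log (n : nat) : (0 < n)%N ->
  ln (n%:R : R) <= 4 * 2 ^+ trunc_log 2 (trunc_log 2 n).
Proof.
move=> n0; set l := trunc_log 2 n; set K := trunc_log 2 l.
have nl : (n < 2 ^ l.+1)%N by exact: trunc_log_ltn.
have lK : (l < 2 ^ K.+1)%N by exact: trunc_log_ltn.
have hn : (n%:R : R) <= 2 ^+ l.+1 by rewrite -natrX ler_nat ltnW.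
apply: (@le_trans _ _ (ln ((2 : R) ^+ l.+1))).
  by rewrite ler_ln ?posrE ?exprn_gt0 ?ltr0n.
rewrite lnXn//.
have l2 : ln (2 : R) <= 2 by exact: ltW (ln_sublinear _).
rewrite -[leLHS]mulr_natr.
rewrite (le_trans (ler_wpM2r (ler0n R l.+1) l2))//.
rewrite (_ : 4 * 2 ^+ K = 2 * (2 ^ K.+1)%:R); last by rewrite natrX exprS; ring.
by rewrite ler_wpM2l// ler_nat.
Qed.

(** With [K] the iterated binary logarithm of [n], the [K] halvings give [C ^+ 2 / 2 ^+ K], of order
    [1 / ln n]. The largest scale exponent is quadratic in [K], hence at most [2 ^ K], so for large
    [n] all scales fit below [n]. The 72 is 18 times the 4 of [ln_le_trunc_log]. *)
Lemma power_growth (q : R) : UMD X -> 0 < q -> has_cotype X q ->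
  exists B : R, exists n0 : nat, forall n, (n0 <= n)%N ->
    opnorm (P n) <= B * (n%:R / ln n%:R).
Proof.
move=> umd q0 cot.
have [p p1 gain] := umd_cotype_gain umd q0 cot.
have Cn : 0 < C ^+ 2 by rewrite exprn_gt0// (lt_le_trans ltr01).
have e0 : 0 < (4 * C ^+ 2)^-1 `^ p by apply: powR_gt0; rewrite invr_gt0 mulr_gt0.
have [H H0 {}gain] := gain _ e0.
have ec0 : 0 <= err_const C tau.
  by rewrite addr_ge0 ?mulr_ge0 ?exprn_ge0.
pose c := (Num.bound (4 * err_const C tau)).+1.
have hc : 4 * err_const C tau <= 2 ^+ c.
  rewrite (le_trans (ltW (archi_boundP _))) ?mulr_ge0//.
  by rewrite -natrX ler_nat (leq_trans (leqnSn _))// ltnW// ltn_expl.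
have [K0 hK0] := poly_le_exp (2 * H.+1) c.
exists (72 * C ^+ 2), (2 ^ (2 ^ K0.+1))%N => n hn.
have n0 : (0 < n)%N by rewrite (leq_trans _ hn)// expn_gt0.
set l := trunc_log 2 n; set K := trunc_log 2 l.
have lK0 : (2 ^ K0.+1 <= l)%N by rewrite trunc_log_max.
have l0 : (0 < l)%N by rewrite (leq_trans _ lK0)// expn_gt0.
have KK0 : (K0 <= K)%N by rewrite ltnW// trunc_log_max.
have Kl : (2 ^ K <= l)%N by exact: trunc_logP.
have ln_n : (2 ^ l <= n)%N by exact: trunc_logP.
(* The part [K] of the margin pays for [2 ^+ K] and the part [c] for the error constant. *)
pose g := (K + c)%N.
have g0 : (0 < g)%N by rewrite /g addnS.
have gl : (2 * g * (K * H.+1) <= l)%N.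
  rewrite (leq_trans _ Kl)// (leq_trans _ (hK0 K KK0))// -/g.
  by rewrite -2!mulnA [(g * (K * _))%N]mulnA [(g * K * _)%N]mulnC.
pose N : R := 2 * n%:R.
have nr : 1 <= n%:R :> R by rewrite ler1n.
have N1 : 1 < N by rewrite /N; lra.
have hN : 2 ^+ (2 * g * (K * H.+1)) <= N.
  apply: (@le_trans _ _ (n%:R)); last by rewrite /N; lra.
  by rewrite -natrX ler_nat (leq_trans _ ln_n)// leq_exp2l.
have herr : 4 * err_const C tau * 2 ^+ K <= 2 ^+ g.
  by rewrite /g exprD mulrC ler_wpM2l ?exprn_ge0.
(* Beyond [m1] the grid resolves all scales and has more than [n] points; [pow_small] then finds a
   grid on which aliasing is negligible. *)
pose m1 := (2 * g * (K * H.+1) + g + n).+1.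
have [m mm1 small] := pow_small HR C1 tau0 Ttau cT m1 N1.
have [m' mE] : exists m', m = m'.+1 by exists m.-1; rewrite prednK// (leq_trans _ mm1).
rewrite mE in mm1 small.
have [w [w1 wm wn]] := @root_of_unity R m'.
have M0 : (0 < 2 ^ m'.+1)%N by rewrite expn_gt0.
have M'r : 0 < (2 ^ m')%:R :> R by rewrite ltr0n expn_gt0.
have ME : (2 ^ m'.+1)%:R = 2 * (2 ^ m')%:R :> R by rewrite expnS natrM.
have wM : cabs (w - 1) <= 8 / (2 ^ m'.+1)%:R.
  rewrite (le_trans wn)// ME le_eqVlt; apply/orP; left; apply/eqP.
  by field; rewrite gt_eqF.
(* It takes [2 ^ m'] steps to get from 1 to -1, which are at distance 2. *)
have wM' : 4 / (2 ^ m'.+1)%:R <= cabs (w - 1).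
  have := cabs_sub1X (2 ^ m') w1; rewrite wm.
  have -> : cabs (-1 - 1 : R[i]) = 2.
    rewrite -opprD -mulr2n.
    have -> : - (1 *+ 2) = (-1) * ((2 : R)%:C) :> R[i] by rewrite mulN1r rmorph_nat.
    by rewrite cabsM cabs_real// {1}/cabs rnormN -/(cabs 1) cabs1 mul1r.
  move=> h; rewrite ME -ler_pdivrMl// in h *.
  rewrite (le_trans _ h)// le_eqVlt; apply/orP; left; apply/eqP.
  by field; rewrite gt_eqF.
have gm : (2 * g * (K * H.+1) + g <= m'.+1)%N.
  by rewrite (leq_trans _ mm1)// /m1 (leq_trans _ (leqnSn _))// leq_addr.
have nM : (n < 2 ^ m'.+1)%N.
  rewrite (leq_trans (ltn_expl n (ltnSn 1)))// leq_exp2l//.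
  by rewrite (leq_trans _ mm1)// /m1 (leq_trans _ (leqnSn _))// leq_addl.
have sq := square_mean_decay HR C1 tau0 Ttau w1 wM wM' M0 p1 erefl H0 g0
  (fun L k => gain _ L k M0) herr gm N1 hN.
have b0 : 0 <= C ^+ 2 / 2 ^+ K by rewrite divr_ge0 ?exprn_ge0.
have lnn : 0 < ln (n%:R : R).
  rewrite ln_gt0// ltr1n (leq_trans _ ln_n)// (@leq_trans (2 ^ 1))//.
  by rewrite leq_exp2l.
apply: opnorm_le => x x1.
rewrite (le_trans (powT_le_square_mean x p1 b0 n0 nM w1 wm small sq))//.
apply: (@le_trans _ _ (18 * (C ^+ 2 / 2 ^+ K) * n%:R)).
  by rewrite ler_piMr// !mulr_ge0.
have K2 : 0 < 2 ^+ K :> R by rewrite exprn_gt0.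
have hln := ln_le_trunc_log n0; rewrite -/l -/K in hln.
rewrite [leRHS]mulrA ler_pdivlMr//.
have cn : 0 <= 18 * (C ^+ 2 / 2 ^+ K) * n%:R by rewrite !mulr_ge0.
rewrite (le_trans (ler_wpM2l cn hln))// le_eqVlt; apply/orP; left; apply/eqP.
by field; rewrite gt_eqF.
Qed.

End growth.

Lemma ln_nat_unbounded {R : realType} (A : R) :
  exists n0 : nat, forall n, (n0 <= n)%N -> A <= ln (n%:R : R).
Proof.
exists (Num.bound (expR A)) => n hn.
have h : expR A <= n%:R.
  by rewrite (le_trans (ltW (archi_boundP (expR_ge0 A))))// ler_nat.
by rewrite -[A]expRK ler_ln ?posrE ?expR_gt0// (lt_le_trans (expR_gt0 A)).
Qed.

Theorem theorem3p1 (R : realType) (X : completeNormedModType R[i])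
    (q qs : R) (T : {linear X -> X}) :
  UMD X ->
  2 <= q -> 2 <= qs ->
  has_cotype X q -> has_cotype (dual X) qs ->
  continuous T -> kreiss_bounded T ->
  let s := Num.min q qs in
  (fun n : nat => opnorm (iter n T)) =O_\oo
    (fun n : nat => n%:R / ln (n%:R : R) `^ s^-1) /\
  (fun n : nat => opnorm (iter n T)) =o_\oo (fun n : nat => n%:R : R).
Proof.
move=> umd q2 qs2 cot _ cT kT s.
have q0 : 0 < q by lra.
have [C C1 [res HR]] := kreiss_resolvent kT.
have tau0 := opnorm_ge0 cT.
have Ttau x := rnorm_opnorm x cT.
have [B [n1 growth]] := power_growth HR C1 tau0 Ttau cT umd q0 cot.
have op_ge0 n : 0 <= opnorm (iter n T).
  exact: (opnorm_ge0 (@powT_continuous _ _ T n cT)).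
pose B' := `|B| + 1.
have B'0 : 0 < B' by rewrite ltr_wpDl.
have [n2 ln1] := @ln_nat_unbounded R 1.
have bound n : (n1 <= n)%N -> (n2 <= n)%N ->
    opnorm (iter n T) <= B' * (n%:R / ln n%:R).
  move=> n1n n2n; rewrite (le_trans (growth n n1n))// ler_wpM2r//.
    by rewrite divr_ge0// (le_trans _ (ln1 n n2n)).
  by rewrite (le_trans (ler_norm B))// lerDl.
split.
- apply/eqO_exP; exists B' => //.
  exists (maxn n1 n2) => // n /=; rewrite geq_max => /andP[n1n n2n].
  have lnn := ln1 n n2n.
  have ln0 : 0 < ln (n%:R : R) := lt_le_trans ltr01 lnn.
  rewrite ger0_norm// (le_trans (bound n n1n n2n))// ler_wpM2l ?(ltW B'0)//.
  rewrite ger0_norm ?divr_ge0 ?powR_ge0// ler_wpM2l//.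
  (* As [ln n] and [s] are at least 1, the power [s^-1] of [ln n] is at most [ln n], so the bound by
     [n / ln n] is stronger. *)
  rewrite lef_pV2 ?posrE ?powR_gt0// ler1_powR//.
  have s1 : 1 <= s by rewrite le_min; lra.
  by rewrite invf_le1// (lt_le_trans ltr01 s1).
- apply/eqoP => e e0.
  have [n3 ln3] := ln_nat_unbounded (B' / e).
  exists (maxn n1 (maxn n2 n3)) => // n /=; rewrite !geq_max => /and3P[n1n n2n n3n].
  have ln0 : 0 < ln (n%:R : R) := lt_le_trans ltr01 (ln1 n n2n).
  rewrite !ger0_norm// (le_trans (bound n n1n n2n))//.
  rewrite mulrCA [leRHS]mulrC ler_wpM2l// ler_pdivrMr// mulrC.
  by rewrite -ler_pdivrMr// ln3.
Qed.
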